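(* Let $F$ be a finite extension of $\mathbf{Q}_p$ with ring of integers $\mathcal{O}$, uniformizer $\varpi$, and residue field of cardinality $q$. Let $A=\mathbf{C}[X_1^{\pm1},X_2^{\pm1}]$ and let $Q(A)$ be its field of fractions. Let $B\subseteq \mathrm{GL}_2$ be the upper triangular Borel subgroup with modular character $\delta_B$, and let $\chi: B(F)\to A^\times$ be the unramified character $\chi\left(\left[\begin{smallmatrix} \varpi^a u_1 & x\\ & \varpi^b u_2\end{smallmatrix}\right]\right)=X_1^aX_2^b$ for $u_1,u_2\in\mathcal{O}^\times$, $x\in F$. Define $$i_{Q(A)}(\chi)=\{f:\mathrm{GL}_2(F)\to Q(A) \text{ locally constant}: f(bg)=(\delta_B^{1/2}\chi)(b)f(g)\ \forall b\in B(F), g\in \mathrm{GL}_2(F)\},$$ and let $i_A(\chi)\subseteq i_{Q(A)}(\chi)$ be the $A$-submodule of those $f$ taking values in $A$. Let $f^{\mathrm{sph}}\in i_A(\chi)$ be given by $f^{\mathrm{sph}}(bk)=(\chi\delta_B^{1/2})(b)$ for $b\in B(F)$, $k\in\mathrm{GL}_2(\mathcal{O})$. Embed $\mathrm{GL}_1\hookrightarrow\mathrm{GL}_2$ via $a\mapsto \mathrm{diag}(a,1)$. Let $l_A$ be the unique $Q(A)$-linear form in $\mathrm{Hom}_{\mathrm{GL}_1(F)}(i_{Q(A)}(\chi),Q(A))$ satisfying $l_A(f^{\mathrm{sph}})=1-q^{-1}X_1X_2^{-1}$. Then $l_A(i_A(\chi))$ is contained in the non-free $A$-submodule of $A$ $$(1-q^{-1/2}X_1)A+(1-q^{-1}X_1X_2^{-1})A=(1-q^{1/2}X_2)A+(1-q^{-1}X_1X_2^{-1})A\subseteq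 A.$$
   Context: $\delta_B\left(\left[\begin{smallmatrix} t_1 & x\\ & t_2\end{smallmatrix}\right]\right)=|t_1/t_2|$ with $|\varpi|=q^{-1}$, and $q^{1/2}$ denotes the positive square root. The space $\mathrm{Hom}_{\mathrm{GL}_1(F)}(i_{Q(A)}(\chi),Q(A))$ of $Q(A)$-linear forms invariant under the action of $\mathrm{diag}(a,1)$, $a\in F^\times$ (acting by right translation), is one-dimensional over $Q(A)$ and every nonzero element is nonvanishing on $f^{\mathrm{sph}}$, so $l_A$ is well defined. *)

(* Defs.v *)
From HB Require Import structures.
From mathcomp Require Import all_boot all_order all_algebra all_field.
From mathcomp Require Import boolp classical_sets functions reals.
From mathcomp Require Import complex mpoly.

Set Implicit Arguments.
Unset Strict Implicit.
Unset Printing Implicit Defensive.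

Import Order.TTheory GRing.Theory Num.Theory.
Local Open Scope ring_scope.

(* Classical choice of inverses, used to turn a commutative ring without zero
   divisors into an idomainType. *)
Section ClassicalUnits.
Variable R : comNzRingType.

Definition cunit : {pred R} := fun x => `[< exists y, y * x = 1 >].

Definition cinv (x : R) : R :=
  if pselect (exists y, y * x = 1) is left ex then sval (cid ex) else x.

Lemma cmulVr : {in cunit, left_inverse 1 cinv *%R}.
Proof.
move=> x /asboolP ex; rewrite /cinv; case: pselect => // ex'.
by case: cid.
Qed.

Lemma cunitPl (x y : R) : y * x = 1 -> x \in cunit.
Proof. by move=> yx1; apply/asboolP; exists y. Qed.

Lemma cinv_out : {in [predC cunit], cinv =1 id}.
Proof.
by move=> x /asboolPn nx; rewrite /cinv; case: pselect.
Qed.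

End ClassicalUnits.

(* The ring Z_p as the inverse limit of the rings Z/p^n: an element is the
   sequence of its canonical representatives in [0, p^n). *)
Definition padic_compat (p : nat) : {pred nat -> int} :=
  fun x => `[< forall n, (x n.+1 %% (p ^ n)%N)%Z = x n >].

(* Primality is a parameter of the type so that the idomainType instance,
   which needs it, can be inferred from the type alone. *)
Record padic_int (p : nat) (p_pr : prime p) : Type :=
  PadicInt { padic_seq :> nat -> int; _ : padic_seq \in padic_compat p }.

Section PadicIntegers.
Variables (p : nat) (p_pr : prime p).

Local Notation pn n := ((p ^ n)%N : int).
Local Notation padic_int := (padic_int p_pr).

HB.instance Definition _ := [isSub for @padic_seq p p_pr].
HB.instance Definition _ := gen_eqMixin padic_int.
HB.instance Definition _ := gen_choiceMixin padic_int.

Implicit Types x y z : padic_int.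

Lemma padic_intP x y : (forall n, x n = y n) -> x = y.
Proof. by move=> xy; apply/val_inj/funext. Qed.

Lemma padic_intS x n : (x n.+1 %% pn n)%Z = x n.
Proof. by case: x => x /= /asboolP. Qed.

Lemma pnS n : (pn n %| pn n.+1)%Z.
Proof. by rewrite dvdzE /= dvdn_exp2l. Qed.

Lemma modpnS (a : int) n : ((a %% pn n.+1)%Z %% pn n)%Z = (a %% pn n)%Z.
Proof.
have /dvdzP[k ->] := pnS n.
by rewrite [in RHS](divz_eq a (k * pn n)) mulrA modzMDl.
Qed.

Lemma padic_mod x n : (x n %% pn n)%Z = x n.
Proof. by rewrite -{1}(padic_intS x n) modz_mod padic_intS. Qed.

Lemma padic_compat_mod (f : nat -> int) :
  (forall n, (f n.+1 = f n %[mod pn n])%Z) ->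
  (fun n => (f n %% pn n)%Z) \in padic_compat p.
Proof. by move=> fS; apply/asboolP => n; rewrite modpnS fS. Qed.

Definition padic_mk f fS : padic_int := PadicInt _ (@padic_compat_mod f fS).

Lemma padic_modS x n : (x n.+1 = x n %[mod pn n])%Z.
Proof. by rewrite padic_intS padic_mod. Qed.

Lemma padic_zeroS n : ((0 : int) = 0 %[mod pn n])%Z.
Proof. by []. Qed.
Lemma padic_oneS n : ((1 : int) = 1 %[mod pn n])%Z.
Proof. by []. Qed.
Lemma padic_oppS x n : (- x n.+1 = - x n %[mod pn n])%Z.
Proof. by rewrite -modzNm padic_modS modzNm. Qed.
Lemma padic_addS x y n : (x n.+1 + y n.+1 = x n + y n %[mod pn n])%Z.
Proof. by rewrite -modzDm !padic_modS modzDm. Qed.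
Lemma padic_mulS x y n : (x n.+1 * y n.+1 = x n * y n %[mod pn n])%Z.
Proof. by rewrite -modzMm !padic_modS modzMm. Qed.

Definition padic_zero := padic_mk padic_zeroS.
Definition padic_one := padic_mk padic_oneS.
Definition padic_opp x := padic_mk (padic_oppS x).
Definition padic_add x y := padic_mk (padic_addS x y).
Definition padic_mul x y := padic_mk (padic_mulS x y).

Lemma padic_addA : associative padic_add.
Proof. by move=> x y z; apply: padic_intP => n /=; rewrite modzDmr modzDml addrA. Qed.
Lemma padic_addC : commutative padic_add.
Proof. by move=> x y; apply: padic_intP => n /=; rewrite addrC. Qed.
Lemma padic_add0 : left_id padic_zero padic_add.
Proof. by move=> x; apply: padic_intP => n /=; rewrite mod0z add0r padic_mod. Qed.
Lemma padic_addN : left_inverse padic_zero padic_opp padic_add.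
Proof. by move=> x; apply: padic_intP => n /=; rewrite modzDml addNr. Qed.

HB.instance Definition _ :=
  GRing.isZmodule.Build padic_int padic_addA padic_addC padic_add0 padic_addN.

Lemma padic_mulA : associative padic_mul.
Proof. by move=> x y z; apply: padic_intP => n /=; rewrite modzMmr modzMml mulrA. Qed.
Lemma padic_mulC : commutative padic_mul.
Proof. by move=> x y; apply: padic_intP => n /=; rewrite mulrC. Qed.
Lemma padic_mul1 : left_id padic_one padic_mul.
Proof. by move=> x; apply: padic_intP => n /=; rewrite modzMml mul1r padic_mod. Qed.
Lemma padic_mulD : left_distributive padic_mul padic_add.
Proof.
move=> x y z; apply: padic_intP => n /=.
by rewrite modzMml modzDm mulrDl.
Qed.
Lemma padic_one_neq0 : padic_one != 0.
Proof.
apply/eqP => /(congr1 (fun x : padic_int => x 1)) /=.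
rewrite mod0z modz_small //= expn1.
by have := prime_gt1 p_pr; case: p => [|[]].
Qed.

HB.instance Definition _ := GRing.Zmodule_isComNzRing.Build padic_int
  padic_mulA padic_mulC padic_mul1 padic_mulD padic_one_neq0.
HB.instance Definition _ := GRing.ComNzRing_hasMulInverse.Build padic_int
  (@cmulVr padic_int) (@cunitPl padic_int) (@cinv_out padic_int).

Lemma padic_modD x m k : (x (m + k)%N %% pn m)%Z = x m.
Proof.
elim: k => [|k IHk]; first by rewrite addn0 padic_mod.
rewrite addnS -IHk -[in RHS](padic_intS x (m + k)).
have /dvdzP[c ->] : (pn m %| pn (m + k))%Z.
  by rewrite dvdzE /= dvdn_exp2l // leq_addr.
by rewrite [in LHS](divz_eq (x (m + k).+1) (c * pn m)) mulrA modzMDl.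
Qed.

Lemma padic_mulf_eq0 x y : x * y = 0 -> (x == 0) || (y == 0).
Proof.
move=> xy0; apply: contrapT => /negP; rewrite negb_or => /andP[x0 y0].
have nz z : z != 0 -> exists n, ~~ (pn n %| z n)%Z.
  move=> z0; apply: contrapT => zn; move/eqP: z0; apply.
  apply: padic_intP => n /=; rewrite mod0z -(padic_mod z n).
  apply/dvdz_mod0P; apply: contrapT => zpn; apply: zn.
  by exists n; apply/negP.
have [m xm] := nz _ x0; have [k yk] := nz _ y0.
have : (pn (m + k) %| x (m + k)%N * y (m + k)%N)%Z.
  apply/dvdz_mod0P.
  by have /(congr1 (fun z : padic_int => z (m + k)%N)) /= := xy0; rewrite mod0z.
have xm' : ~~ (pn m %| x (m + k)%N)%Z.
  by apply: contra xm => /dvdz_mod0P; rewrite padic_modD => ->; rewrite dvdz0.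
have yk' : ~~ (pn k %| y (m + k)%N)%Z.
  apply: contra yk => /dvdz_mod0P; rewrite addnC padic_modD => ->.
  by rewrite dvdz0.
move: xm' yk'; rewrite !dvdzE !absz_nat abszM.
move: `|x _|%N `|y _|%N => a b na nb.
have a0 : (0 < a)%N by case: a na => //; rewrite dvdn0.
have b0 : (0 < b)%N by case: b nb => //; rewrite dvdn0.
rewrite pfactor_dvdn ?muln_gt0 ?a0 // lognM //.
move: na nb; rewrite !pfactor_dvdn // -!ltnNge => na nb.
by rewrite leqNgt -addSn leq_add // ltnW.
Qed.

HB.instance Definition _ :=
  GRing.ComUnitRing_isIntegral.Build padic_int padic_mulf_eq0.

End PadicIntegers.

Notation padic p_pr := {fraction (padic_int p_pr)}.

(* The Laurent polynomial ring C[X_1^{±1}, X_2^{±1}], as the subring of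
   C(X_1, X_2) of the fractions whose denominator is a power of X_1 X_2. *)
Section Laurent.
Variable C : fieldType.

Local Notation ratfun := {fraction {mpoly C[2]}}.

Let x1 : {mpoly C[2]} := mpolyX C U_(inord 0).
Let x2 : {mpoly C[2]} := mpolyX C U_(inord 1).

Definition laurent_pred : {pred ratfun} := fun f =>
  `[< exists P n, f * FracField.tofrac (x1 * x2) ^+ n = FracField.tofrac P >].

Lemma laurent_subring : subring_closed laurent_pred.
Proof.
split; first by apply/asboolP; exists 1, 0%N; rewrite mulr1 tofrac1.
- move=> f g /asboolP[P [n fP]] /asboolP[Q [m gQ]]; apply/asboolP.
  exists (P * (x1 * x2) ^+ m - Q * (x1 * x2) ^+ n), (n + m)%N.
  rewrite tofracB !(tofracM (_ : {mpoly C[2]}) (_ ^+ _)) !tofracXn -fP -gQ.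
  by rewrite mulrBl exprD !mulrA [g * _ * _]mulrAC.
- move=> f g /asboolP[P [n fP]] /asboolP[Q [m gQ]]; apply/asboolP.
  by exists (P * Q), (n + m)%N; rewrite tofracM -fP -gQ exprD mulrACA.
Qed.

HB.instance Definition _ :=
  GRing.isSubringClosed.Build ratfun laurent_pred laurent_subring.

Record laurent : Type :=
  Laurent { laurent_frac :> ratfun; _ : laurent_frac \in laurent_pred }.

HB.instance Definition _ := [isSub for laurent_frac].
HB.instance Definition _ := [Choice of laurent by <:].
HB.instance Definition _ := [SubChoice_isSubComNzRing of laurent by <:].
HB.instance Definition _ := GRing.ComNzRing_hasMulInverse.Build laurent
  (@cmulVr laurent) (@cunitPl laurent) (@cinv_out laurent).

Lemma laurent_mulf_eq0 (f g : laurent) : f * g = 0 -> (f == 0) || (g == 0).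
Proof.
move=> /(congr1 val); rewrite rmorphM rmorph0 => /eqP.
by rewrite mulf_eq0 -!(inj_eq val_inj).
Qed.

HB.instance Definition _ :=
  GRing.ComUnitRing_isIntegral.Build laurent laurent_mulf_eq0.

Lemma laurent_poly (P : {mpoly C[2]}) : FracField.tofrac P \in laurent_pred.
Proof. by apply/asboolP; exists P, 0%N; rewrite expr0 mulr1. Qed.

Definition laurent_of_poly P := Laurent (laurent_poly P).

Definition laurentC (c : C) : laurent := laurent_of_poly c%:MP.
Definition X1 : laurent := laurent_of_poly x1.
Definition X2 : laurent := laurent_of_poly x2.

Let x_neq0 i : mpolyX C U_(i) != 0 :> {mpoly C[2]}.
Proof. by rewrite -msupp_eq0 msuppX. Qed.

Lemma laurentX_unit : (X1 \is a GRing.unit) && (X2 \is a GRing.unit).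
Proof.
suff : X1 * X2 \is a GRing.unit by rewrite unitrM.
have yP : (FracField.tofrac (x1 * x2))^-1 \in laurent_pred.
  apply/asboolP; exists 1, 1%N; rewrite expr1 tofrac1 mulVf // tofrac_eq0.
  by rewrite mulf_neq0 ?x_neq0.
apply: (@cunitPl _ _ (Laurent yP)); apply/val_inj => /=.
rewrite -tofracM mulVf // tofrac_eq0.
by rewrite mulf_neq0 ?x_neq0.
Qed.

End Laurent.

Section RingOfIntegers.
Variables (p : nat) (p_pr : prime p) (F : fieldExtType (padic p_pr)).

Definition padic_embed (z : padic_int p_pr) : F := (FracField.tofrac z)%:A.

Definition ring_of_integers : set F := [set x | integralOver padic_embed x].

(* The valuation is written additively on F^*; its value at 0 is junk. There
   is exactly one such valuation: the integers determine it. *)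
Record normalized_valuation : Type := NormalizedValuation {
  valuation :> F -> int;
  valuationM : forall x y,
    x != 0 -> y != 0 -> valuation (x * y) = valuation x + valuation y;
  valuationD : forall x y, x != 0 -> y != 0 -> x + y != 0 ->
    Order.min (valuation x) (valuation y) <= valuation (x + y);
  valuation_uniformizer : exists varpi, varpi != 0 /\ valuation varpi = 1;
  valuation_integers : forall x,
    ring_of_integers x <-> (x != 0 -> 0 <= valuation x) }.

Lemma valuation1 (v : normalized_valuation) : v 1 = 0.
Proof.
by apply: (addrI (v 1)); rewrite -valuationM ?oner_neq0 // mulr1 addr0.
Qed.

Lemma valuationV (v : normalized_valuation) x : x != 0 -> v x^-1 = - v x.
Proof.
move=> x0; apply: (addrI (v x)).
by rewrite -valuationM ?invr_eq0 // mulfV // valuation1 subrr.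
Qed.

Lemma valuationXz (v : normalized_valuation) x (n : int) :
  x != 0 -> v (x ^ n) = n * v x.
Proof.
move=> x0; have vX k : v (x ^+ k) = k%:Z * v x.
  elim: k => [|k IHk]; first by rewrite expr0 mul0r valuation1.
  by rewrite exprS valuationM ?expf_neq0 // IHk -addn1 PoszD mulrDl mul1r addrC.
case: n => k; first exact: vX.
by rewrite NegzE -exprnN valuationV ?expf_neq0 // vX mulNr.
Qed.

Lemma valuation_int_unit (v : normalized_valuation) u : u != 0 ->
  ring_of_integers u -> ring_of_integers u^-1 -> v u = 0.
Proof.
move=> u0 /(valuation_integers v)/(_ u0) vu0.
move=> /(valuation_integers v); rewrite invr_eq0 => /(_ u0).
by rewrite valuationV // oppr_ge0 => vu; apply/eqP; rewrite eq_le vu vu0.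
Qed.

Definition val_ge (v : normalized_valuation) (n : int) : set F :=
  [set x | x != 0 -> n <= v x].

(* The maximal ideal is val_ge v 1; rep lists one representative of each of
   its cosets in the ring of integers. *)
Definition residue_field_card (v : normalized_valuation) (q : nat) : Prop :=
  exists rep : 'I_q -> F, (forall i, ring_of_integers (rep i)) /\
    forall x, ring_of_integers x -> exists! i, val_ge v 1 (x - rep i).

End RingOfIntegers.

Section GL2.
Variable F : fieldType.

Record gl2 : Type := GL2 { gl2_mx :> 'M[F]_2; _ : gl2_mx \in unitmx }.

HB.instance Definition _ := [isSub for gl2_mx].

Lemma gl2_unit (g : gl2) : gl2_mx g \in unitmx.
Proof. by case: g. Qed.

Lemma gl2_mul_subproof (g h : gl2) : gl2_mx g *m gl2_mx h \in unitmx.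
Proof. by rewrite unitmx_mul !gl2_unit. Qed.

Definition gl2_mul (g h : gl2) : gl2 := GL2 (gl2_mul_subproof g h).

Lemma gl2_mulA : associative gl2_mul.
Proof. by move=> g h k; apply/val_inj/mulmxA. Qed.

Definition borel : set gl2 := [set b : gl2 | b 1 0 = 0].

Definition gl1_mx (a : F) : 'M[F]_2 :=
  diag_mx (\row_(j < 2) if j == 0 then a else 1).

Lemma gl1_subproof (a : F) : a != 0 -> gl1_mx a \in unitmx.
Proof.
move=> a0; rewrite unitmxE det_diag unitfE; apply/prodf_neq0 => i _.
by rewrite mxE; case: ifP => // _; rewrite oner_neq0.
Qed.

(* The embedding a |-> diag(a, 1) of GL_1. *)
Definition gl1_embed (a : F) (a0 : a != 0) : gl2 := GL2 (gl1_subproof a0).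

End GL2.

Section PrincipalSeries.
Variables (p : nat) (p_pr : prime p) (F : fieldExtType (padic p_pr)).
Variables (v : normalized_valuation F) (q : nat) (R : realType).

Local Notation C := R[i].
Local Notation A := (laurent C).
Local Notation QA := {fraction (laurent C)}.
Local Notation "f %:F" := (FracField.tofrac f) : ring_scope.

Definition gl2_integers : set (gl2 F) := [set k : gl2 F |
  (forall i j, ring_of_integers (k i j)) /\ ring_of_integers (\det k)^-1].

Definition abs_val (x : F) : R := if x == 0 then 0 else q%:R ^ (- v x).

Definition borel_modulus (b : gl2 F) : R := abs_val (b 0 0 / b 1 1).

(* The unramified character depends only on the valuations of the diagonal
   entries; unram_charE is its usual description by a uniformizer. *)
Definition unram_char (b : gl2 F) : A := X1 C ^ v (b 0 0) * X2 C ^ v (b 1 1).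

Lemma unram_charE (varpi u1 u2 : F) (m n : int) (b : gl2 F) :
  varpi != 0 -> v varpi = 1 ->
  u1 != 0 -> ring_of_integers u1 -> ring_of_integers u1^-1 ->
  u2 != 0 -> ring_of_integers u2 -> ring_of_integers u2^-1 ->
  b 0 0 = varpi ^ m * u1 -> b 1 1 = varpi ^ n * u2 ->
  unram_char b = X1 C ^ m * X2 C ^ n.
Proof.
move=> w0 vw u10 Ou1 Ou1V u20 Ou2 Ou2V b00 b11.
rewrite /unram_char b00 b11 !valuationM ?expfz_neq0 // !valuationXz // vw !mulr1.
by rewrite (valuation_int_unit v u10) // (valuation_int_unit v u20) // !addr0.
Qed.

Definition normalized_char (b : gl2 F) : QA :=
  (laurentC (Num.sqrt (borel_modulus b))%:C%C * unram_char b)%:F.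

(* The topology of GL_2(F) is induced by that of 2 x 2 matrices. *)
Definition locally_constant (T : Type) (f : gl2 F -> T) : Prop :=
  forall g : gl2 F, exists n : int, forall h : gl2 F,
    (forall i j, val_ge v n (h i j - g i j)) -> f h = f g.

Definition prin_series_pred : {pred (gl2 F -> QA^o)} := fun f =>
  `[< locally_constant f /\
      forall b g, borel b -> f (gl2_mul b g) = normalized_char b * f g >].

Lemma val_geW n m (x : F) : m <= n -> val_ge v n x -> val_ge v m x.
Proof. by move=> mn nx /nx; apply: le_trans. Qed.

Lemma prin_series_submod : submod_closed prin_series_pred.
Proof.
split.
  apply/asboolP; split=> [g|b g _]; first by exists 0.
  by rewrite mulr0.
move=> c f f' /asboolP[fc fB] /asboolP[fc' fB']; apply/asboolP; split.
  move=> g; have [n fn] := fc g; have [m fm] := fc' g.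
  exists (Order.max n m) => h hg.
  by congr (_ *: _ + _); [apply: fn | apply: fm] => i j;
    apply: val_geW (hg i j); rewrite le_max lexx ?orbT.
move=> b g bB; rewrite !fctE fB // fB' //.
by rewrite mulrDr [in RHS]mulrCA.
Qed.

HB.instance Definition _ :=
  GRing.isSubmodClosed.Build QA (gl2 F -> QA^o) prin_series_pred
    prin_series_submod.

Record prin_series : Type := PrinSeries {
  prin_series_fun :> gl2 F -> QA^o;
  _ : prin_series_fun \in prin_series_pred }.

HB.instance Definition _ := [isSub for prin_series_fun].
HB.instance Definition _ := [Choice of prin_series by <:].
HB.instance Definition _ := [SubChoice_isSubLmodule of prin_series by <:].

Lemma val_ge_add n (x y : F) :
  val_ge v n x -> val_ge v n y -> val_ge v n (x + y).
Proof.
have [->|x0] := eqVneq x 0; first by rewrite add0r.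
have [->|y0] := eqVneq y 0; first by rewrite addr0.
move=> nx ny xy0; apply: le_trans (valuationD v x0 y0 xy0).
by rewrite le_min nx ?ny.
Qed.

Lemma val_ge_mul n m (x y : F) :
  val_ge v n x -> val_ge v m y -> val_ge v (n + m) (x * y).
Proof.
move=> nx my; rewrite /val_ge /= mulf_eq0 negb_or => /andP[x0 y0].
by rewrite valuationM // lerD ?nx ?my.
Qed.

Lemma rtranslate_subproof (t : gl2 F) (f : prin_series) :
  (fun g => f (gl2_mul g t)) \in prin_series_pred.
Proof.
case: f => f /= /asboolP[fc fB]; apply/asboolP; split; last first.
  by move=> b g bB; rewrite -gl2_mulA fB.
move=> g; have [n fn] := fc (gl2_mul g t).
have [m tm] : exists m : int, forall i j, val_ge v m (t i j).
  exists (- \sum_i \sum_j `|v (t i j)|) => i j _.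
  rewrite lerNl; apply: le_trans (ler_norm _) _; rewrite normrN.
  rewrite (bigD1 i) //= (bigD1 j) //= -addrA lerDl addr_ge0 //.
    by apply: sumr_ge0.
  by apply: sumr_ge0 => k _; apply: sumr_ge0.
exists (n - m) => h hg; apply: fn => i j.
rewrite /= !mxE -sumrB; elim/big_ind: _ => [|x y|k _]; last first.
- by rewrite -mulrBl -(subrK m n); apply: val_ge_mul.
- exact: val_ge_add.
- by rewrite /val_ge /= eqxx.
Qed.

Definition rtranslate (t : gl2 F) (f : prin_series) : prin_series :=
  PrinSeries (rtranslate_subproof t f).

(* The A-lattice of the functions with values in A. *)
Definition integral_series : set prin_series :=
  [set f | forall g, exists a : A, f g = a%:F].

Definition spherical (f : prin_series) : Prop :=
  forall b k, borel b -> gl2_integers k ->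
    f (gl2_mul b k) = normalized_char b.

Definition gl1_invariant (l : {linear prin_series -> QA^o}) : Prop :=
  forall a (a0 : a != 0) f, l (rtranslate (gl1_embed a0) f) = l f.

End PrincipalSeries.

Section Modules.

Definition ideal2 (A : comNzRingType) (x y : A) : set A :=
  [set z | exists a b, z = x * a + y * b].

Definition is_basis (A : nzRingType) (M : lmodType A) (N B : set M) : Prop :=
  [/\ (B `<=` N)%classic,
      forall x, N x -> exists (s : seq M) (c : M -> A),
        (forall b, b \in s -> B b) /\ x = \sum_(b <- s) c b *: b
    & forall (s : seq M) (c : M -> A), uniq s -> (forall b, b \in s -> B b) ->
        \sum_(b <- s) c b *: b = 0 -> forall b, b \in s -> c b = 0].

Definition free_submodule (A : nzRingType) (M : lmodType A) (N : set M) : Prop :=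
  exists B : set M, is_basis N B.

End Modules.

(* Main.v *)
(* A function f in the principal series is determined by its value at the Weyl
   element and by phi(c) = f([1 0; c 1]), and diag(a, 1) acts on phi by
   alpha^v(a) phi(c a), where alpha = q^(-1/2) X_1; put eps = q^(1/2) X_2 and
   beta = alpha / eps = q^-1 X_1 / X_2.  By compactness of O, any f is fixed by
   the diag(u, 1) with u in 1 + varpi^n O, so averaging f over the finite group
   O^* / (1 + varpi^n O) changes l f by an invertible constant only, and makes
   phi(c) depend on v(c) alone.  After subtraction of a multiple of the spherical
   function, the average is an A-combination of the functions 1_(varpi^j O).
   Each of these is a combination of two translates of the spherical function,
   whence l(1_(varpi^j O)) = alpha^j (1 - eps^-1), which lies in the ideal.
   The compactness of O comes from that of a Z_p-lattice: on the lattice, the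
   vectors outside p times the lattice have bounded valuation.
   For non-freeness, a generator of the ideal would give a and b with
   (1 - alpha) b = (1 - eps) a and 1 in (a, b); differentiating at the point
   alpha = eps = 1 shows that a and b both vanish there. *)
Require Import Defs.
From HB Require Import structures.
From mathcomp Require Import all_boot all_order all_algebra all_field.
From mathcomp Require Import boolp classical_sets functions reals.
From mathcomp Require Import complex mpoly.
From mathcomp Require Import ring zify.

Set Implicit Arguments.
Unset Strict Implicit.
Unset Printing Implicit Defensive.

Import Order.TTheory GRing.Theory Num.Theory.
Local Open Scope ring_scope.

(** * Compactness of Z_p *)

Lemma fin_uniform (T : finType) (P : nat -> T -> Prop) :
  (forall m n t, (m <= n)%N -> P m t -> P n t) ->
  (forall t, exists n, P n t) -> exists n, forall t, P n t.
Proof.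
move=> Pmono Pex; have /choice[f Pf] := Pex.
exists (\max_t f t)%N => t; apply: Pmono (Pf t).
exact: leq_bigmax.
Qed.

Section PadicIntegers.
Variables (p : nat) (p_pr : prime p).
Local Notation Zp := (padic_int p_pr).
Local Notation pn n := ((p ^ n)%N : int).

Lemma padic_congr (x y : Zp) m n : (m <= n)%N -> x n = y n -> x m = y m.
Proof. by move=> /subnKC <- xy; rewrite -(padic_modD x m (n - m)) xy padic_modD. Qed.

(** Compactness of Z_p^d by subdivision: a ball without a uniform bound contains a ball of the next
    level without one, and the centres of these nested balls converge to a point that contradicts
    the local hypothesis. *)
Lemma padic_compact d (Q : nat -> ('I_d -> Zp) -> Prop) :
    (forall m n x, (m <= n)%N -> Q m x -> Q n x) ->
    (forall x : 'I_d -> Zp, exists n N, forall y : 'I_d -> Zp,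
        (forall i, y i n = x i n) -> Q N y) ->
  exists N, forall x, Q N x.
Proof.
move=> Qmono Qloc.
pose good n (x : 'I_d -> Zp) :=
  exists N, forall y : 'I_d -> Zp, (forall i, y i n = x i n) -> Q N y.
have bad_step n (x : 'I_d -> Zp) : ~ good n x ->
    exists x' : 'I_d -> Zp, (forall i, x' i n = x i n) /\ ~ good n.+1 x'.
  move=> bad_x; apply: contrapT => no_bad; apply: bad_x.
  (* [t] runs over the finitely many sub-balls of level [n.+1]; one that does not meet the ball of
     [x] imposes no condition. *)
  pose P N (t : {ffun 'I_d -> 'I_(p ^ n.+1)}) := forall y : 'I_d -> Zp,
    (forall i, y i n.+1 = t i) -> (forall i, y i n = x i n) -> Q N y.
  have [|t|N PN] := @fin_uniform _ P.
  - by move=> k m t km Pk y yt yx; apply: Qmono km _; apply: Pk.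
  - have [[y0 [y0t y0x]]|nex] := pselect (exists y : 'I_d -> Zp, (forall i, y i n.+1 = t i) /\
      (forall i, y i n = x i n)); last first.
      by exists 0%N => y yt yx; case: nex; exists y.
    have [[N gN]|bad] := pselect (good n.+1 y0); last first.
      by case: no_bad; exists y0.
    by exists N => y yt _; apply: gN => i; rewrite yt y0t.
  exists N => y yx.
  have lt_y i : (`|y i n.+1| < p ^ n.+1)%N.
    rewrite -ltz_nat -(padic_mod (y i)) abszE ger0_norm ?modz_ge0 //.
      by rewrite ltz_pmod // ltz_nat expn_gt0 prime_gt0.
    by rewrite eqz_nat -lt0n expn_gt0 prime_gt0.
  apply: (PN [ffun i => Ordinal (lt_y i)]) => // i; rewrite ffunE /=.
  rewrite -(padic_mod (y i)) abszE ger0_norm ?modz_ge0 //.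
  by rewrite eqz_nat -lt0n expn_gt0 prime_gt0.
(* At level 0 all points are congruent, so the ball is the whole space. *)
have [g0|bad0] := pselect (good 0%N (fun=> 0)).
  have [N gN] := g0; exists N => x; apply: gN => i.
  by rewrite -(padic_mod (x i)) modz1.
pose next n (x : 'I_d -> Zp) :=
  if pselect (exists x' : 'I_d -> Zp, (forall i, x' i n = x i n) /\ ~ good n.+1 x')
  is left e then sval (cid e) else x.
pose s := fix s n := if n is n'.+1 then next n' (s n') else fun=> 0.
have bad_s n : ~ good n (s n).
  elim: n => [|n IHn] //=; rewrite /next; case: pselect => [e|[]]; last exact: bad_step.
  by case: cid => x' /= [].
have sS n i : s n.+1 i n = s n i n.
  rewrite /= /next; case: pselect => [e|[]]; last exact: bad_step.
  by case: cid => x' /= [].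
(* The diagonal sequence [s n i n] is coherent and defines the limit of the centres. *)
have zP i n : (s n.+1 i n.+1 = s n i n %[mod pn n])%Z.
  by rewrite padic_intS sS padic_mod.
have [n [N gN]] := Qloc (fun i => padic_mk p_pr (zP i)).
case: (bad_s n); exists N => y ys; apply: gN => i.
by rewrite ys /= padic_mod.
Qed.

(** Compactness is applied to the negated congruence, which persists when the level grows, as
    [padic_compact] demands. *)
Lemma padic_solve (a b : Zp) :
  (forall n, exists y, (a * y) n = b n) -> exists y, a * y = b.
Proof.
move=> sol; apply: contrapT => nosol.
pose Q n (y : 'I_1 -> Zp) := (a * y ord0) n <> b n.
have [|y|N QN] := @padic_compact 1 Q.
- by move=> m n y mn Qm /(padic_congr mn).
- have [n yn] : exists n, (a * y ord0) n <> b n.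
    apply: contrapT => yn; apply: nosol; exists (y ord0); apply: padic_intP => n.
    by apply: contrapT => abn; apply: yn; exists n.
  by exists n, n => y' /(_ ord0) y'y; rewrite /Q /= y'y.
by have [y] := sol N; apply: (QN (fun=> y)).
Qed.

Lemma padic_addE (x y : Zp) n : (x + y) n = ((x n + y n) %% pn n)%Z.
Proof. by []. Qed.

Lemma padic_natE (k n : nat) : (k%:R : Zp) n = (k %% p ^ n)%N.
Proof.
elim: k => [|k IHk]; first by rewrite /= mod0z mod0n.
rewrite mulrSr padic_addE IHk.
have -> : (1 : Zp) n = ((1 : int) %% pn n)%Z by [].
by rewrite -modz_nat modzDm -PoszD addn1 modz_nat.
Qed.

Lemma padic_mulE (x y : Zp) n : (x * y) n = ((x n * y n) %% pn n)%Z.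
Proof. by []. Qed.

Lemma padic_intS_const (k : int) n : (k = k %[mod pn n])%Z. Proof. by []. Qed.

Lemma padic_dvd_pX (x : Zp) k : x k = 0 -> exists y, x = (p%:R ^+ k) * y.
Proof.
move=> xk0; suff [y <-] : exists y, (p%:R ^+ k) * y = x by exists y.
apply: padic_solve => m.
(* Division by p^k loses k digits, so the quotient is read off at level [m + k]. *)
have /dvdz_mod0P/dvdzP[t xE] : (x (m + k)%N %% pn k)%Z = 0 by rewrite addnC padic_modD.
exists (padic_mk p_pr (padic_intS_const t)).
rewrite -natrX padic_mulE padic_natE /= -modz_nat modzMmr modzMml.
by rewrite mulrC -xE padic_modD.
Qed.

(** If b is nonzero at level k, then at every level n >= k the gcd of b and p^n is p^j with j <= k,
    and a Bezout relation solves b y = p^k modulo p^n. *)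
Lemma padic_dvd_exp (b : Zp) : b != 0 -> exists k y, b * y = p%:R ^+ k.
Proof.
move=> b0; have [k bk] : exists k, b k <> 0.
  apply: contrapT => bk; move/eqP: b0; apply; apply: padic_intP => n.
  by rewrite /= mod0z; apply: contrapT => bn; apply: bk; exists n.
exists k; apply: padic_solve => m.
suff [y yE] : exists y, (b * y) (k + m)%N = (p%:R ^+ k : Zp) (k + m)%N.
  by exists y; apply: padic_congr yE; rewrite leq_addl.
set n := (k + m)%N.
have /dvdn_pfactor-/(_ p_pr)[j jn gE] : (gcdn `|b n| (p ^ n) %| p ^ n)%N by exact: dvdn_gcdr.
have jk : (j <= k)%N.
  rewrite leqNgt; apply/negP => kj; apply: bk.
  rewrite -(padic_modD b k m) -/n; apply/dvdz_mod0P.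
  rewrite dvdzE /= (dvdn_trans _ (dvdn_gcdl _ (p ^ n))) // gE.
  by rewrite dvdn_exp2l // ltnW.
have [u [w uw]] := Bezoutz (b n) (pn n).
have gE' : gcdz (b n) (pn n) = pn j by rewrite /gcdz absz_nat gE.
exists (padic_mk p_pr (padic_intS_const (u * (p ^ (k - j))%N))).
rewrite padic_mulE -natrX padic_natE -modz_nat /= modzMmr.
have -> : b n * (u * (p ^ (k - j))%N) = pn k + - (w * (p ^ (k - j))%N) * pn n.
  have -> : pn k = (u * b n + w * pn n) * (p ^ (k - j))%N.
    by rewrite uw gE' -PoszM -expnD subnKC.
  by ring.
by rewrite addrC modzMDl.
Qed.

End PadicIntegers.

(** * Valuations and lattices in F *)

Lemma frac_numden (R : idomainType) (z : {fraction R}) :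
  exists a b, b != 0 /\ z = FracField.tofrac a / FracField.tofrac b.
Proof.
elim/quotW: z => x; exists (frac x).1, (frac x).2; have x2 := denom_ratioP x; split=> //.
apply: (canRL (mulfK _)); first by rewrite tofrac_eq0.
unlock FracField.tofrac; rewrite -[LHS]FracField.pi_mul; apply/eqmodP.
rewrite /= FracField.equivfE /FracField.mulf.
by rewrite !numden_Ratio ?oner_neq0 ?mulr1 // mulrC.
Qed.

Section LocalField.
Variables (p : nat) (p_pr : prime p) (F : fieldExtType (padic p_pr)).
Variable v : normalized_valuation F.
Local Notation Zp := (padic_int p_pr).
Local Notation pn n := ((p ^ n)%N : int).
Local Notation iota := (@padic_embed p p_pr F).
Local Notation O := (@ring_of_integers p p_pr F).

HB.instance Definition _ := GRing.RMorphism.copy (@padic_embed p p_pr F)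
  (in_alg F \o @FracField.tofrac (padic_int p_pr)).

Lemma padic_embed_inj : injective iota.
Proof.
move=> x y /(fmorph_inj (in_alg F)) /eqP.
by rewrite tofrac_eq => /eqP.
Qed.

Lemma ring_of_integersE x : O x <-> val_ge v 0 x.
Proof. exact: valuation_integers. Qed.

Lemma val_ge0 n : val_ge v n 0.
Proof. by rewrite /val_ge /= eqxx. Qed.

Lemma valN x : v (- x) = v x.
Proof.
have [->|x0] := eqVneq x 0; first by rewrite oppr0.
have vN1 : v (-1) = 0.
  have : v (-1) + v (-1) = 0.
    by rewrite -valuationM ?oppr_eq0 ?oner_neq0 // mulrNN mulr1 valuation1.
  by lia.
by rewrite -mulN1r valuationM ?oppr_eq0 ?oner_neq0 // vN1 add0r.
Qed.

Lemma val_ge_opp n x : val_ge v n x -> val_ge v n (- x).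
Proof. by rewrite /val_ge /= oppr_eq0 valN. Qed.

Lemma val_ge_sub n x y : val_ge v n x -> val_ge v n y -> val_ge v n (x - y).
Proof. by move=> nx ny; apply: val_ge_add => //; apply: val_ge_opp. Qed.

Lemma padic_embed_int z : val_ge v 0 (iota z).
Proof. exact/ring_of_integersE/integral_id. Qed.

Lemma natr_p_neq0 : p%:R != 0 :> Zp.
Proof.
apply/eqP => /(congr1 (fun z : Zp => z 2)) /=.
rewrite padic_natE mod0z expnS expn1 modn_small => [p0|].
  by have := prime_gt0 p_pr; lia.
by have := prime_gt1 p_pr; nia.
Qed.

Lemma natF_p_neq0 : p%:R != 0 :> F.
Proof.
by rewrite -(rmorph_nat iota) -(rmorph0 iota) (inj_eq padic_embed_inj) natr_p_neq0.
Qed.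

(** Otherwise 1/p would be integral; its monic equation, multiplied by p^n, reads 1 + p (...) = 0 in
    Z_p, which fails modulo p. *)
Lemma val_p_gt0 : 0 < v p%:R.
Proof.
have vp0 : 0 <= v p%:R.
  have := @padic_embed_int p%:R; rewrite /val_ge /= rmorph_nat; apply; exact: natF_p_neq0.
rewrite lt_neqAle vp0 andbT; apply/negP => /eqP vp.
have [P mP] : O p%:R^-1.
  by apply/ring_of_integersE => _; rewrite valuationV ?natF_p_neq0 // -vp oppr0.
rewrite /root horner_coef size_map_poly_id0; last first.
  rewrite (monicP mP). by rewrite rmorph1 oner_neq0.
have [n sP] : exists n, size P = n.+1.
  exists (size P).-1; rewrite prednK // size_poly_gt0; exact: monic_neq0.
have lP : P`_n = 1 by move/monicP: mP; rewrite lead_coefE sP.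
rewrite sP => /eqP /(congr1 (fun z => z * iota (p%:R ^+ n))).
rewrite mul0r mulr_suml big_ord_recr /= coef_map lP /= rmorph1 mul1r rmorphXn rmorph_nat.
rewrite -exprMn mulVf ?natF_p_neq0 // expr1n.
under eq_bigr => i _.
  have -> : (p%:R : F) ^+ n = p%:R ^+ i * p%:R ^+ (n - i.+1).+1.
    by rewrite -exprD; congr (_ ^+ _); have := ltn_ord i; lia.
  rewrite coef_map /= mulrA -(mulrA (iota _)) -exprMn mulVf ?natF_p_neq0 // expr1n.
  rewrite mulr1 exprS mulrCA -(rmorph_nat iota) -rmorphXn -!rmorphM.
  over.
rewrite /= -rmorph_sum -(rmorph1 iota) -rmorphD -(rmorph0 iota) => /padic_embed_inj.
rewrite -mulr_sumr => /(congr1 (fun z : Zp => z 1)).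
rewrite padic_addE padic_mulE padic_natE expn1 modnn mul0r mod0z add0r.
rewrite [X in (X %% _)%Z]/= [RHS]/= expn1 modz_mod mod0z modz_small //.
by rewrite /= ltz_nat prime_gt1.
Qed.

Definition padic_comb d (e : 'I_d -> F) (x : 'I_d -> Zp) : F :=
  \sum_i iota (x i) * e i.

Lemma padic_combB d (e : 'I_d -> F) x y :
  padic_comb e (fun i => x i - y i) = padic_comb e x - padic_comb e y.
Proof. by rewrite -sumrB; apply: eq_bigr => i _; rewrite rmorphB mulrBl. Qed.

Lemma padic_combZ d (e : 'I_d -> F) a x :
  padic_comb e (fun i => a * x i) = iota a * padic_comb e x.
Proof. by rewrite mulr_sumr; apply: eq_bigr => i _; rewrite rmorphM mulrA. Qed.

Lemma val_ge_sum (I : Type) (r : seq I) (P : pred I) (f : I -> F) n :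
  (forall i, P i -> val_ge v n (f i)) -> val_ge v n (\sum_(i <- r | P i) f i).
Proof.
move=> fn; elim/big_ind: _ => //; first exact: val_ge0.
by move=> x y; apply: val_ge_add.
Qed.

Lemma val_ge_padic_comb d (e : 'I_d -> F) :
  exists B : nat, forall x, val_ge v (- B%:Z) (padic_comb e x).
Proof.
exists (\sum_i `|v (e i)|)%N => x; apply: val_ge_sum => i _.
rewrite -[- _]add0r; apply: val_ge_mul; first exact: padic_embed_int.
by move=> _; rewrite (bigD1 i) //=; lia.
Qed.

Lemma val_ge_pX n (x : F) : val_ge v n x -> forall k, val_ge v (n + k%:Z) (p%:R ^+ k * x).
Proof.
move=> nx k; rewrite addrC; apply: val_ge_mul nx => _.
by rewrite exprnP valuationXz ?natF_p_neq0 //; have := val_p_gt0; nia.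
Qed.

(** Vectors congruent modulo p^n differ by p^n times a vector, and v(p) >= 1; [B] bounds the
    denominators of the lattice. *)
Lemma padic_comb_cont d (e : 'I_d -> F) : exists B : nat, forall n (x y : 'I_d -> Zp),
  (forall i, y i n = x i n) -> val_ge v (n%:Z - B%:Z) (padic_comb e y - padic_comb e x).
Proof.
have [B Be] := val_ge_padic_comb e; exists B => n x y yx.
have /choice[t tE] : forall i, exists t, y i - x i = p%:R ^+ n * t.
  move=> i; apply: padic_dvd_pX; rewrite padic_addE yx.
  by rewrite [(- x i) n]/= modzDmr subrr mod0z.
rewrite -padic_combB (_ : (fun i => _) = fun i => p%:R ^+ n * t i); last exact/funext.
rewrite padic_combZ rmorphXn rmorph_nat addrC.
exact: val_ge_pX.
Qed.

(** A vector that is nonzero modulo p has a nonzero combination by freeness, whose valuation is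
    locally bounded; compactness makes the bound uniform. *)
Lemma padic_comb_bounded d (e : 'I_d -> F) :
    (forall x, padic_comb e x = 0 -> forall i, x i = 0) ->
  exists M : nat, forall x : 'I_d -> Zp,
    (exists i, x i 1 <> 0) -> ~ val_ge v M (padic_comb e x).
Proof.
move=> e_free; have [B Be] := padic_comb_cont e.
pose Q (M : nat) (x : 'I_d -> Zp) := (exists i, x i 1 <> 0) ->
  ~ val_ge v M (padic_comb e x).
apply: (@padic_compact p p_pr d Q) => [m n x mn Qm xi nx|x].
  by apply: Qm => //; apply: val_geW nx.
have [[i xi]|x0] := pselect (exists i, x i 1 <> 0); last first.
  by exists 1%N, 0%N => y yx [i xi]; rewrite yx in xi; case: x0; exists i.
have ex0 : padic_comb e x != 0.
  by apply/eqP => /e_free/(_ i) xi0; apply: xi; rewrite xi0 /= mod0z.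
exists (`|v (padic_comb e x)| + 1 + B)%N, (`|v (padic_comb e x)| + 1)%N.
move=> y yx _ My; set M : int := (_ + 1)%N in My.
have My' : val_ge v M (padic_comb e y - padic_comb e x).
  by apply: val_geW (Be _ _ _ yx); rewrite /M; lia.
have /(_ ex0) : val_ge v M (padic_comb e x).
  by rewrite -[padic_comb e x](subKr (padic_comb e y)); apply: val_ge_sub.
by rewrite /M; lia.
Qed.

(** The denominator divides a power of p. *)
Lemma frac_padic (z : padic p_pr) : exists k a, z * p%:R ^+ k = FracField.tofrac a.
Proof.
have [a [b [b0 ->]]] := frac_numden z.
have [k [y yE]] := padic_dvd_exp b0; exists k, (a * y).
rewrite -(rmorph_nat (@FracField.tofrac Zp)) -rmorphXn -yE !rmorphM mulrA mulfVK //.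
by rewrite tofrac_eq0.
Qed.
End LocalField.

(** * The ring of integers inside a lattice *)

Section LocalField.
Variables (p : nat) (p_pr : prime p) (F : fieldExtType (padic p_pr)).
Variable v : normalized_valuation F.
Local Notation Zp := (padic_int p_pr).
Local Notation iota := (@padic_embed p p_pr F).

Lemma padic_combE d (e : 'I_d -> F) (x : 'I_d -> Zp) :
  padic_comb e x = \sum_i FracField.tofrac (x i) *: e i.
Proof. by apply: eq_bigr => i _; rewrite /padic_embed mulr_algl. Qed.

Lemma padic_lattice : exists d (e : 'I_d -> F),
  (forall x : 'I_d -> Zp, padic_comb e x = 0 -> forall i, x i = 0) /\
  (forall z, exists k (x : 'I_d -> Zp), p%:R ^+ k * z = padic_comb e x).
Proof.
pose X := vbasis {:F}; exists (\dim {:F}), (fun i => X`_i); split=> [x|z].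
  have /freeP X_free := basis_free (vbasisP {:F}).
  rewrite padic_combE => /X_free x0 i; apply/eqP.
  by rewrite -(tofrac_eq0 (x i)) x0.
have /choice[ka kaP] : forall i, exists ka : nat * Zp,
    coord X i z * p%:R ^+ ka.1 = FracField.tofrac ka.2.
  by move=> i; have [k [a ka]] := frac_padic (coord X i z); exists (k, a).
(* The sum over j != i completes the exponent of coordinate i to the common one. *)
exists (\sum_i (ka i).1)%N, (fun i => p%:R ^+ (\sum_(j | j != i) (ka j).1)%N * (ka i).2).
rewrite padic_combE [in LHS](coord_vbasis (memvf z)) mulr_sumr.
apply: eq_bigr => i _; rewrite rmorphM /= -kaP rmorphXn rmorph_nat mulrCA -exprD.
rewrite -scalerAr -(rmorph_nat (in_alg F)) -rmorphXn /= mulr_algl scalerA.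
by rewrite [in LHS](bigD1 i) //= addnC.
Qed.

(** Let k be least with p^k z in the lattice. If k > 0, the coordinates of p^k z are not all
    divisible by p, while its valuation is at least k; so k is at most the bound M for such
    vectors. *)
Lemma padic_lattice_integers : exists d (e : 'I_d -> F) (M : nat),
  forall z, val_ge v 0 z -> exists x : 'I_d -> Zp, p%:R ^+ M * z = padic_comb e x.
Proof.
have [d [e [e_free e_gen]]] := padic_lattice.
have [M Me] := padic_comb_bounded v e_free; exists d, e, M => z Oz.
have [z0|z0] := eqVneq z 0.
  exists (fun=> 0); rewrite z0 mulr0 /padic_comb big1 // => i _.
  by rewrite rmorph0 mul0r.
have ex_k : exists k, `[< exists x : 'I_d -> Zp, p%:R ^+ k * z = padic_comb e x >].
  by have [k kz] := e_gen z; exists k; apply/asboolP.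
case: (ex_minnP ex_k) => k /asboolP[x xE] k_min.
suff kM : (k <= M)%N.
  exists (fun i => p%:R ^+ (M - k) * x i).
  by rewrite padic_combZ -xE rmorphXn rmorph_nat mulrA -exprD subnK.
case: k xE k_min => // k xE k_min; rewrite leqNgt; apply/negP => Mk.
apply: (Me x); last first.
  rewrite -xE; apply: (@val_geW _ _ _ _ (0 + k.+1%:Z)); first by lia.
  exact: val_ge_pX.
apply: contrapT => nx; suff : (k.+1 <= k)%N by rewrite ltnn.
apply: k_min; apply/asboolP.
have /choice[y yE] : forall i, exists y, x i = p%:R ^+ 1 * y.
  by move=> i; apply: padic_dvd_pX; apply: contrapT => xi; apply: nx; exists i.
exists y; apply: (mulfI (natF_p_neq0 F)).
rewrite mulrA -exprS xE -(rmorph_nat iota) -padic_combZ.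
by apply: eq_bigr => i _; rewrite yE.
Qed.

(** O lies in the image of Z_p^d under the continuous map [c] of the proof, so compactness of Z_p^d
    applies. *)
Lemma integers_uniform (T : Type) (f : F -> T) :
    (forall x, exists n, forall y, val_ge v n (y - x) -> f y = f x) ->
  exists n, forall x, val_ge v 0 x -> forall y, val_ge v n (y - x) -> f y = f x.
Proof.
move=> f_lc; have [d [e [M eM]]] := padic_lattice_integers.
have [B Be] := padic_comb_cont v e.
pose c (x : 'I_d -> Zp) : F := p%:R ^- M * padic_comb e x.
pose Q (N : nat) x := forall h, val_ge v N (h - c x) -> f h = f (c x).
have [|x|N QN] := @padic_compact p p_pr d Q.
- by move=> m n x mn Qm h hn; apply: Qm; apply: val_geW hn.
- have [n fn] := f_lc (c x).
  (* This level makes up for the loss [B] of [padic_comb] and for the factor p^-M. *)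
  exists (`|n| + B + `|v (p%:R ^- M)|)%N, `|n|%N => y yx.
  have yx_n : val_ge v n (c y - c x).
    rewrite -mulrBr -(subrK (v (p%:R ^- M)) n) addrC.
    apply: val_ge_mul; first by [].
    by apply: val_geW (Be _ _ _ yx); lia.
  move=> h hy; rewrite (fn (c y)) //; apply: fn.
  rewrite -(subrK (c y) h) -addrA; apply: val_ge_add yx_n.
  by apply: val_geW hy; lia.
- exists N => x /eM[y yE].
  suff -> : x = c y by apply: QN.
  by rewrite /c -yE mulKf // expf_neq0 ?natF_p_neq0.
Qed.

End LocalField.

(** * Averaging over units *)

Section Units.
Variables (p : nat) (p_pr : prime p) (F : fieldExtType (padic p_pr)).
Variable v : normalized_valuation F.

Definition val_unit (x : F) := (x != 0) && (v x == 0).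

Lemma val_unitM x y : val_unit x -> val_unit y -> val_unit (x * y).
Proof.
move=> /andP[x0 /eqP vx] /andP[y0 /eqP vy].
by rewrite /val_unit mulf_neq0 // valuationM // vx vy.
Qed.

Lemma val_unitV x : val_unit x -> val_unit x^-1.
Proof.
by move=> /andP[x0 /eqP vx]; rewrite /val_unit invr_eq0 x0 valuationV // vx oppr0 /=.
Qed.

Lemma val_ge_unit n u x : val_unit u -> val_ge v n x -> val_ge v n (u * x).
Proof.
move=> /andP[_ /eqP vu] nx; rewrite -[n]add0r; apply: val_ge_mul nx => _.
by rewrite vu.
Qed.

Lemma val_unit_close n x y : 0 < n -> val_unit x -> val_ge v n (x - y) -> val_unit y.
Proof.
move=> n0 /andP[x0 /eqP vx] xy.
have yE : y = x - (x - y) by rewrite subKr.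
have y0 : y != 0.
  by apply/eqP => y0; move: xy; rewrite y0 subr0 => /(_ x0); lia.
rewrite /val_unit y0 /= eq_le; apply/andP; split.
  rewrite leNgt; apply/negP => vy.
  have /(_ x0) : val_ge v 1 x; last by lia.
  rewrite -(subrK y x); apply: val_ge_add; last by move=> _; lia.
  by apply: val_geW xy; lia.
have : val_ge v 0 y; last by apply.
rewrite yE; apply: val_ge_sub; first by move=> _; rewrite vx.
by apply: val_geW xy; lia.
Qed.

Lemma val_geC n x y : val_ge v n (x - y) -> val_ge v n (y - x).
Proof. by move=> /val_ge_opp; rewrite opprB. Qed.

Lemma val_ge_trans n x y z :
  val_ge v n (x - y) -> val_ge v n (y - z) -> val_ge v n (x - z).
Proof. by move=> xy yz; rewrite -(subrK y x) -addrA; apply: val_ge_add. Qed.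

(** * Representatives of residue classes *)

Section Residues.
Variables (q : nat) (hq : residue_field_card v q).

(** Digit expansion: passing from n to n + 1 adds a residue representative times [w ^+ n]. *)
Lemma integers_finite_cover (n : nat) : exists s : seq F,
  forall x, val_ge v 0 x -> exists2 r, r \in s & val_ge v n (x - r).
Proof.
have [rep [_ repP]] := hq; have [w [w0 vw]] := valuation_uniformizer v.
elim: n => [|n [s sP]].
  by exists [:: 0] => x Ox; exists 0; rewrite ?mem_head // subr0.
exists [seq r + w ^+ n * rep i | r <- s, i <- enum 'I_q] => x /sP[r rs xr].
have Oy : val_ge v 0 (w ^- n * (x - r)).
  rewrite -(addNr n%:Z); apply: val_ge_mul xr => _.
  by rewrite exprnN valuationXz // vw; lia.
have /repP[i [yi _]] := (ring_of_integersE v _).2 Oy.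
exists (r + w ^+ n * rep i); first by apply/allpairsP; exists (r, i); rewrite mem_enum.
have -> : x - (r + w ^+ n * rep i) = w ^+ n * (w ^- n * (x - r) - rep i).
  by rewrite mulrBr mulVKf ?expf_neq0 // opprD addrA.
rewrite -addn1 PoszD; apply: val_ge_mul yi => _.
by rewrite exprnP valuationXz // vw mulr1.
Qed.

(** [s] represents the units modulo varpi^n, and multiplication by u permutes these classes. Since n
    > 0, whatever is congruent to a unit is a unit. *)
Lemma unit_average (n : nat) : (0 < n)%N -> exists s : seq F,
  [/\ s != [::], forall r, r \in s -> val_unit r &
    forall (V : nmodType) (g : F -> V),
      (forall x y, val_unit x -> val_ge v n (x - y) -> g x = g y) ->
    forall u, val_unit u -> \sum_(r <- s) g (u * r) = \sum_(r <- s) g r].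
Proof.
move=> n0; have [s0 s0P] := integers_finite_cover n.
(* Taking the first congruent member of the cover makes [rho x] depend on the class of x only. *)
pose rho x := nth 0 s0 (find (fun r => `[< val_ge v n (x - r) >]) s0).
have rhoP x : val_ge v 0 x -> rho x \in s0 /\ val_ge v n (x - rho x).
  move=> /s0P[r rs xr].
  have hs : has (fun r => `[< val_ge v n (x - r) >]) s0.
    by apply/hasP; exists r => //; apply/asboolP.
  split; first by rewrite mem_nth -?has_find.
  by have /asboolP := nth_find 0 hs.
have rho_eq x y : val_ge v n (x - y) -> rho x = rho y.
  move=> xy; rewrite /rho; congr nth; apply: eq_find => r.
  apply: asbool_equiv_eq; split=> [xr|yr].
    exact: val_ge_trans (val_geC xy) xr.
  exact: val_ge_trans xy yr.
have unitO x : val_unit x -> val_ge v 0 x by move=> /andP[_ /eqP vx] _; rewrite vx.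
pose s := undup [seq rho x | x <- s0 & val_unit x].
have rho_s x : val_unit x -> rho x \in s.
  move=> ux; have [xs xr] := rhoP _ (unitO _ ux).
  rewrite mem_undup (rho_eq _ _ xr); apply/map_f; rewrite mem_filter xs andbT.
  by apply: val_unit_close ux xr; rewrite ltz_nat.
have s_unit r : r \in s -> val_unit r /\ rho r = r.
  rewrite mem_undup => /mapP[x]; rewrite mem_filter => /andP[ux _] ->.
  have [_ xr] := rhoP _ (unitO _ ux); split; last by rewrite -(rho_eq _ _ xr).
  by apply: val_unit_close ux xr; rewrite ltz_nat.
exists s; split=> [|r /s_unit[]//|V g g_eq u uu].
  have u1 : val_unit 1 by rewrite /val_unit oner_neq0 valuation1 eqxx.
  by apply/eqP => s_nil; have := rho_s _ u1; rewrite s_nil.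
have -> : \sum_(r <- s) g (u * r) = \sum_(r <- s) g (rho (u * r)).
  apply: eq_big_seq => r /s_unit[ur _]; have uur := val_unitM uu ur.
  by apply: g_eq => //; have [] := rhoP _ (unitO _ uur).
rewrite -(big_map (fun r => rho (u * r)) predT g); apply: perm_big.
(* An injective self-map of a finite list without repetition is a permutation of it. *)
have inj : {in s &, injective (fun r => rho (u * r))}.
  move=> r r' /s_unit[ur rE] /s_unit[ur' rE'] rr'.
  have [_ c] := rhoP _ (unitO _ (val_unitM uu ur)).
  have [_ c'] := rhoP _ (unitO _ (val_unitM uu ur')).
  rewrite -rE -rE'; apply: rho_eq.
  have := val_ge_trans c (val_geC _); rewrite rr' => /(_ _ c').
  rewrite -mulrBr => /(val_ge_unit (val_unitV uu)).
  by rewrite mulKf //; case/andP: uu.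
have us : uniq (map (fun r => rho (u * r)) s) by rewrite map_inj_in_uniq ?undup_uniq.
apply: uniq_perm; rewrite ?undup_uniq // => r.
have sub : {subset map (fun r => rho (u * r)) s <= s}.
  by move=> _ /mapP[r' /s_unit[ur' _] ->]; apply: rho_s; apply: val_unitM.
by have [_ ->] := uniq_min_size us sub (eq_leq (esym (size_map _ _))).
Qed.

End Residues.
End Units.

(** * The ideal *)

Lemma divr_mul_cancel (A : comUnitRingType) (a b c x y : A) :
  b * y \is a GRing.unit -> c * b = a -> a * x / (b * y) = c * x / y.
Proof.
rewrite unitrM => /andP[ub uy] <-; rewrite invrM // !mulrA.
by rewrite [_ * b * x]mulrAC [_ * b / y]mulrAC mulrK.
Qed.

Section Ideal.
Variables (A : idomainType) (x y : A).
Hypotheses (ux : x \is a GRing.unit) (uy : y \is a GRing.unit).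

(** With the unit z = x / y, 1 - x = z (1 - y) + (1 - z). *)
Lemma ideal2_div : ideal2 (1 - x) (1 - x / y) = ideal2 (1 - y) (1 - x / y).
Proof.
pose z := x / y; have xE : x = z * y by rewrite mulrVK.
have zV : z^-1 * z = 1 by rewrite mulVr // unitrM unitrV ux uy.
apply/seteqP; split=> _ [a [b ->]]; rewrite -/z xE.
  by exists (z * a), (a + b); ring.
exists (z^-1 * a), (b - z^-1 * a).
have -> : (1 - y) * a = z^-1 * z * ((1 - y) * a) by rewrite zV mul1r.
by ring.
Qed.

Hypothesis no_bezout : forall a b s t : A,
  (1 - x) * b = (1 - y) * a -> a * s + b * t <> 1.

Lemma one_sub_neq0 : 1 - x != 0.
Proof.
apply/eqP => x1; apply: (@no_bezout 0 1 0 1); last by rewrite mulr0 add0r mulr1.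
by rewrite x1 mul0r mulr0.
Qed.

Lemma one_sub_div_neq0 : 1 - x / y != 0.
Proof.
apply/eqP => xy1; have xy : x = y.
  by rewrite -[y]mul1r (subr0_eq xy1) mulrVK.
by apply: (@no_bezout 1 1 1 0); rewrite ?xy // mulr1 mulr0 addr0.
Qed.

(** Distinct elements b, d of a basis would satisfy the relation d b - b d = 0, so a basis of this
    nonzero ideal is a single generator d; the quotients of 1 - x and 1 - y by d then contradict
    [no_bezout]. *)
Lemma ideal2_not_free : ~ @free_submodule A A^o (ideal2 (1 - x) (1 - x / y)).
Proof.
rewrite ideal2_div => -[B [BI Bgen Bfree]].
have memx : ideal2 (1 - y) (1 - x / y) (1 - x).
  by rewrite -ideal2_div; exists 1, 0; ring.
have memy : ideal2 (1 - y) (1 - x / y) (1 - y) by exists 1, 0; ring.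
have [d Bd] : exists d, B d.
  have [s [c [sB xE]]] := Bgen _ memx.
  case: s sB xE => [|d s] sB xE; last by exists d; apply/sB/mem_head.
  by have := one_sub_neq0; rewrite xE big_nil eqxx.
have Buniq b : B b -> b = d.
  move=> Bb; apply/eqP; apply: contraT => bd.
  have Bs z : z \in [:: b; d] -> B z by rewrite !inE => /orP[] /eqP->.
  have us : uniq [:: b; d] by rewrite /= inE bd.
  pose c z : A := if z == b then d else - b.
  have cE : \sum_(z <- [:: b; d]) c z *: (z : A^o) = 0.
    rewrite !big_cons big_nil addr0 /c eqxx eq_sym (negPf bd) /=.
    by rewrite -[d *: _]/(d * b) -[- b *: _]/(- b * d); ring.
  have := Bfree _ _ us Bs cE d; rewrite /c eq_sym (negPf bd) !inE eqxx orbT => /(_ isT)/eqP.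
  rewrite oppr_eq0 => /eqP b0.
  have := Bfree _ _ us Bs cE b; rewrite /c eqxx !inE eqxx => /(_ isT) d0.
  by rewrite b0 d0 eqxx in bd.
have dvd z : ideal2 (1 - y) (1 - x / y) z -> exists a, z = d * a.
  move=> /Bgen[s [c [sB ->]]]; exists (\sum_(b <- s) c b).
  rewrite mulr_sumr; apply: eq_big_seq => b /sB/Buniq ->.
  exact: mulrC.
have [a aE] := dvd _ memx; have [b bE] := dvd _ memy.
have [s [t dE]] := BI _ Bd.
have d0 : d != 0.
  by apply: contraTneq one_sub_neq0 => d0; rewrite aE d0 mul0r eqxx.
pose z := x / y; have xE : x = z * y by rewrite mulrVK.
(* As 1 - z = (1 - x) - z (1 - y), the membership of d becomes d = (1 - x) t + (1 - y) (s - z t), to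
   be divided by d. *)
apply: (@no_bezout a b t (s - z * t)); first by rewrite aE bE; ring.
apply: (mulfI d0); rewrite mulr1 [RHS]dE mulrDr !mulrA -aE -bE -/z xE.
by ring.
Qed.

End Ideal.

(** * Laurent polynomials: clearing denominators and derivatives at a point *)

Section Laurent.
Variable C : fieldType.
Local Notation A := (laurent C).

Lemma laurent_of_poly_is_zmod_morphism : zmod_morphism (@laurent_of_poly C).
Proof. by move=> P Q; apply/val_inj; rewrite rmorphB /= rmorphB. Qed.

Lemma laurent_of_poly_is_monoid_morphism : monoid_morphism (@laurent_of_poly C).
Proof.
split=> [|P Q]; apply/val_inj; first by rewrite rmorph1 /= rmorph1.
by rewrite rmorphM /= rmorphM.
Qed.

HB.instance Definition _ := GRing.isZmodMorphism.Build {mpoly C[2]} A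
  (@laurent_of_poly C) laurent_of_poly_is_zmod_morphism.
HB.instance Definition _ := GRing.isMonoidMorphism.Build {mpoly C[2]} A
  (@laurent_of_poly C) laurent_of_poly_is_monoid_morphism.

Lemma laurent_of_poly_inj : injective (@laurent_of_poly C).
Proof. by move=> P Q /(congr1 val)/= /eqP; rewrite tofrac_eq => /eqP. Qed.

HB.instance Definition _ := GRing.RMorphism.copy (@laurentC C)
  (@laurent_of_poly C \o @mpolyC 2 C).

(** Allowing all large exponents lets several elements be cleared by the same one. *)
Lemma laurent_clear (a : A) : exists n0, forall n, (n0 <= n)%N ->
  exists P, a * (X1 C * X2 C) ^+ n = laurent_of_poly P.
Proof.
have /asboolP[P [n aP]] := valP a; exists n => m nm.
exists (P * ('X_(inord 0) * 'X_(inord 1)) ^+ (m - n)).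
have XE : X1 C * X2 C = laurent_of_poly ('X_(inord 0) * 'X_(inord 1)).
  by rewrite rmorphM.
have aE : a * (X1 C * X2 C) ^+ n = laurent_of_poly P.
  by apply/val_inj; rewrite XE -rmorphXn [LHS]rmorphM /= tofracXn.
by rewrite -(subnKC nm) exprD mulrA aE XE addKn [RHS]rmorphM [in RHS]rmorphXn.
Qed.

Variables (k : C) (k0 : k != 0).
Local Notation alpha := (laurentC k^-1 * X1 C).
Local Notation eps := (laurentC k * X2 C).
Local Notation x1 := ('X_(inord 0) : {mpoly C[2]}).
Local Notation x2 := ('X_(inord 1) : {mpoly C[2]}).

Lemma laurentC_unit (c : C) : c != 0 -> laurentC c \is a GRing.unit.
Proof. by move=> c0; rewrite rmorph_unit ?unitfE. Qed.

Lemma alpha_unit : alpha \is a GRing.unit.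
Proof.
by rewrite unitrM laurentC_unit ?invr_eq0 //; case/andP: (laurentX_unit C).
Qed.

Lemma eps_unit : eps \is a GRing.unit.
Proof. by rewrite unitrM laurentC_unit //; case/andP: (laurentX_unit C). Qed.

Lemma div_alpha_eps : alpha / eps = laurentC (k ^+ 2)^-1 * X1 C / X2 C.
Proof.
apply: divr_mul_cancel; first exact: eps_unit.
by rewrite -rmorphM expr2 invfM mulfVK.
Qed.

Lemma inord0_neq1 : (inord 0 : 'I_2) != inord 1.
Proof. by rewrite -val_eqE /= !inordK. Qed.

(* Both relations are differentiated and evaluated at the point
   [alpha = eps = 1], where [1 - alpha] and [1 - eps] vanish. *)
Lemma laurent_no_bezout (a b s t : A) :
  (1 - alpha) * b = (1 - eps) * a -> a * s + b * t <> 1.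
Proof.
move=> ab st.
have [na Pa_] := laurent_clear a; have [nb Pb_] := laurent_clear b.
have [ns Ps_] := laurent_clear s; have [nt Pt_] := laurent_clear t.
pose n := (na + nb + ns + nt)%N.
have [|Pa aE] := Pa_ n; first by rewrite /n; lia.
have [|Pb bE] := Pb_ n; first by rewrite /n; lia.
have [|Ps sE] := Ps_ n; first by rewrite /n; lia.
have [|Pt tE] := Pt_ n; first by rewrite /n; lia.
have PaPb : (1 - k^-1%:MP * x1) * Pb = (1 - k%:MP * x2) * Pa.
  apply: laurent_of_poly_inj; rewrite !rmorphM !rmorphB !rmorphM !rmorph1 /= -aE -bE.
  by rewrite !mulrA -[RHS]/((1 - eps) * a * _) -ab.
have PsPt : Pa * Ps + Pb * Pt = (x1 * x2) ^+ (n + n).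
  apply: laurent_of_poly_inj; rewrite rmorphD !rmorphM rmorphXn rmorphM /= -aE -bE -sE -tE.
  rewrite -[RHS]/((X1 C * X2 C) ^+ (n + n)) exprD -[RHS]mul1r -st.
  by rewrite mulrDl ![_ * (_ ^+ n * _)]mulrACA.
(* The point X1 = k, X2 = k^-1. *)
pose w (i : 'I_2) := if i == inord 0 then k else k^-1.
have w1 : w (inord 0) = k by rewrite /w eqxx.
have w2 : w (inord 1) = k^-1 by rewrite /w eq_sym (negPf inord0_neq1).
have ev i : (((1 - k^-1%:MP * x1) * Pb)^`M(i)).@[w] = (((1 - k%:MP * x2) * Pa)^`M(i)).@[w].
  by rewrite PaPb.
have U (i j : 'I_2) : ('X_j^`M(i) : {mpoly C[2]}) = (i == j)%:R.
  rewrite mderivX mnm1E eq_sym; case: eqP => [->|_]; last by rewrite scale0r.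
  by rewrite -[X in 'X_[X - _]]add0m addmK mpolyX0 scale1r.
(* The first factor vanishes at [w], so only its derivative survives in the Leibniz rule. *)
have evE (i j : 'I_2) (c : C) P : c * w j = 1 ->
    (((1 - c%:MP * 'X_j) * P)^`M(i)).@[w] = - (c * (i == j)%:R) * P.@[w].
  move=> cw; rewrite mderivM mderivB mderivM -mpolyC1 !mderivC mpolyC1 U mul0r !add0r.
  rewrite mevalD !mevalM mevalN mevalB !mevalM !mevalC mevalXU ?meval1 cw subrr mul0r addr0.
  by rewrite raddfMn /= meval1.
(* The derivative in X2 kills the side of 1 - alpha and leaves k Pa(w) = 0; the derivative in X1
   does the same for Pb. *)
have Pa0 : Pa.@[w] = 0.
  have := ev (inord 1); rewrite !evE ?w1 ?w2 ?mulVf ?mulfV //.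
  rewrite eqxx eq_sym (negPf inord0_neq1) mulr0 mulr1 oppr0 mul0r => /esym/eqP.
  by rewrite mulf_eq0 oppr_eq0 (negPf k0) => /eqP.
have Pb0 : Pb.@[w] = 0.
  have := ev (inord 0); rewrite !evE ?w1 ?w2 ?mulVf ?mulfV //.
  rewrite eqxx (negPf inord0_neq1) mulr0 mulr1 oppr0 mul0r => /eqP.
  by rewrite mulf_eq0 oppr_eq0 invr_eq0 (negPf k0) => /eqP.
have := congr1 (meval w) PsPt.
rewrite mevalD !mevalM Pa0 Pb0 !mul0r addr0 rmorphXn /= mevalM !mevalXU w1 w2.
by rewrite mulfV // expr1n => /eqP; rewrite eq_sym oner_eq0.
Qed.

End Laurent.

(** * The big cell of GL_2 *)

Lemma rmorphXz (R S : unitRingType) (f : {rmorphism R -> S}) (x : R) (n : int) :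
  x \is a GRing.unit -> f (x ^ n) = f x ^ n.
Proof.
move=> ux; case: n => n; first exact: rmorphXn.
by rewrite !NegzE -!exprnN rmorphV ?unitrX // rmorphXn.
Qed.

(** Absorbs the square root of the modulus, a power of a = q^(1/2), into the two variables. *)
Lemma exprz_twist (A : idomainType) (a x y : A) (m n : int) :
    a \is a GRing.unit -> x \is a GRing.unit -> y \is a GRing.unit ->
  a ^ (n - m) * (x ^ m * y ^ n) = (a^-1 * x) ^ m * (a * y) ^ n.
Proof.
move=> ua ux uy; rewrite !exprzMl ?unitrV // exprz_inv exprzDr //.
by rewrite [RHS]mulrACA [X in X * _]mulrC.
Qed.

Section GL2.
Variable F : fieldType.

Definition mx2 (a b c d : F) : 'M[F]_2 :=
  \matrix_(i < 2, j < 2) if i == 0 then (if j == 0 then a else b)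
                         else (if j == 0 then c else d).

Lemma det_mx2 (M : 'M[F]_2) : \det M = M 0 0 * M 1 1 - M 0 1 * M 1 0.
Proof.
rewrite (expand_det_row _ 0) !big_ord_recl big_ord0 addr0 /cofactor !det_mx11 !mxE.
rewrite !expr0 /= !expr1 mul1r mulN1r mulrN.
by congr (M _ _ * M _ _ - M _ _ * M _ _); apply/val_inj.
Qed.

Lemma mx2_unit (a b c d : F) : a * d - b * c != 0 -> mx2 a b c d \in unitmx.
Proof. by move=> h; rewrite unitmxE det_mx2 !mxE unitfE. Qed.

Definition gl2_of (a b c d : F) (h : a * d - b * c != 0) : gl2 F := GL2 (mx2_unit h).

Lemma gl2_eq (g h : gl2 F) : g 0 0 = h 0 0 -> g 0 1 = h 0 1 ->
  g 1 0 = h 1 0 -> g 1 1 = h 1 1 -> g = h.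
Proof.
move=> h00 h01 h10 h11; apply/val_inj/matrixP => i j /=.
have ordE (n : 'I_2) : n = 0 \/ n = 1.
  by case: n => [[|[|//]] ?]; [left | right]; apply/val_inj.
by case: (ordE i) => ->; case: (ordE j) => ->.
Qed.

Lemma gl2_mulE (g h : gl2 F) i j : gl2_mul g h i j = g i 0 * h 0 j + g i 1 * h 1 j.
Proof.
rewrite mxE !big_ord_recl big_ord0 addr0; congr (_ + g i _ * h _ j); exact/val_inj.
Qed.

Lemma gl2_det (g : gl2 F) : g 0 0 * g 1 1 - g 0 1 * g 1 0 != 0.
Proof. by rewrite -det_mx2 -unitfE -unitmxE gl2_unit. Qed.

Lemma nlow_subproof (c : F) : 1 * 1 - 0 * c != 0.
Proof. by rewrite mul0r subr0 mulr1 oner_neq0. Qed.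
Definition nlow c := gl2_of (nlow_subproof c).

Lemma wlow_subproof (d : F) : 0 * d - (-1) * 1 != 0.
Proof. by rewrite mul0r sub0r mulN1r opprK oner_neq0. Qed.
(** The Weyl element times the upper unipotent matrix with entry d. *)
Definition wlow d := gl2_of (wlow_subproof d).

Lemma upper_subproof (x y z : F) : x != 0 -> z != 0 -> x * z - y * 0 != 0.
Proof. by move=> x0 z0; rewrite mulr0 subr0 mulf_neq0. Qed.
Definition upper x y z x0 z0 := gl2_of (@upper_subproof x y z x0 z0).

Lemma gl2E a b c d h : let g := @gl2_of a b c d h in
  [/\ g 0 0 = a, g 0 1 = b, g 1 0 = c & g 1 1 = d].
Proof. by split; rewrite mxE. Qed.

Lemma gl1_embedE (a : F) (a0 : a != 0) : let g := gl1_embed a0 in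
  [/\ g 0 0 = a, g 0 1 = 0, g 1 0 = 0 & g 1 1 = 1].
Proof. by split; rewrite !mxE. Qed.

End GL2.

(** * The normalized character in powers of alpha and eps *)

Section NormalizedCharacter.
Variables (p : nat) (p_pr : prime p) (F : fieldExtType (padic p_pr)).
Variables (v : normalized_valuation F) (q : nat) (R : realType).
Hypothesis q_gt0 : (0 < q)%N.

Local Notation C := R[i].
Local Notation A := (laurent C).
Local Notation QA := {fraction (laurent C)}.
Local Notation "f %:F" := (FracField.tofrac f) : ring_scope.
Local Notation sqrtq := ((Num.sqrt (q%:R : R))%:C%C : C).
Local Notation alpha := (laurentC sqrtq^-1 * X1 C).
Local Notation eps := (laurentC sqrtq * X2 C).
Local Notation V := (prin_series v q R).

Lemma sqrtq_neq0 : sqrtq != 0.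
Proof.
by rewrite fmorph_eq0 sqrtr_eq0 -ltNge ltr0n.
Qed.

Lemma sqrtq_sqr : sqrtq ^+ 2 = q%:R.
Proof. by rewrite -rmorphXn sqr_sqrtr ?ler0n // rmorph_nat. Qed.

Lemma normalized_charE (b : gl2 F) : borel b ->
  normalized_char v q R b = (alpha ^ v (b 0 0) * eps ^ v (b 1 1))%:F.
Proof.
move=> b10; have := gl2_det b; rewrite b10 mulr0 subr0 mulf_eq0 negb_or => /andP[b0 b1].
rewrite /normalized_char /unram_char /borel_modulus /abs_val mulf_eq0 invr_eq0.
rewrite (negPf b0) (negPf b1) /= valuationM ?invr_eq0 // valuationV //.
set m := v _; set n := v _; congr (_ %:F).
have s0 : Num.sqrt (q%:R : R) != 0 by rewrite sqrtr_eq0 -ltNge ltr0n.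
have -> : Num.sqrt ((q%:R : R) ^ (- (m - n))) = Num.sqrt (q%:R : R) ^ (n - m).
  rewrite opprB -{1}(sqr_sqrtr (ler0n R q)) exprnP exprzAC -exprnP sqrtr_sqr ger0_norm //.
  by rewrite exprz_ge0 ?sqrtr_ge0.
have [uX1 uX2] := andP (laurentX_unit C).
have uk : laurentC sqrtq \is a GRing.unit by rewrite laurentC_unit ?sqrtq_neq0.
rewrite rmorphXz ?unitfE // rmorphXz ?unitfE ?sqrtq_neq0 //=.
rewrite (_ : laurentC sqrtq^-1 = (laurentC sqrtq)^-1); last first.
  by rewrite -[RHS]rmorphV ?unitfE ?sqrtq_neq0.
exact: exprz_twist.
Qed.

End NormalizedCharacter.

(** * Charts of the projective line and the action of diag(a, 1) *)

Section PrincipalSeries.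
Variables (p : nat) (p_pr : prime p) (F : fieldExtType (padic p_pr)).
Variables (v : normalized_valuation F) (q : nat) (R : realType).

Local Notation A := (laurent R[i]).
Local Notation QA := {fraction (laurent R[i])}.
Local Notation "f %:F" := (FracField.tofrac f) : ring_scope.
Local Notation V := (prin_series v q R).

Variables (alpha eps : A).
Hypotheses (ua : alpha \is a GRing.unit) (ue : eps \is a GRing.unit).
Hypothesis charE : forall b : gl2 F, borel b ->
  normalized_char v q R b = (alpha ^ v (b 0 0) * eps ^ v (b 1 1))%:F.

Definition mu (m n : int) : A := alpha ^ m * eps ^ n.

Lemma borel_upper (x y z : F) (x0 : x != 0) (z0 : z != 0) : borel (upper y x0 z0).
Proof. by have [_ _] := gl2E (upper_subproof y x0 z0). Qed.

Lemma prin_seriesM (f : V) (b g : gl2 F) : borel b ->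
  f (gl2_mul b g) = (mu (v (b 0 0)) (v (b 1 1)))%:F * f g.
Proof. by move=> bB; have /asboolP[_ ->//] := valP f; rewrite charE. Qed.

Lemma prin_series_upper (f : V) x y z (x0 : x != 0) (z0 : z != 0) g :
  f (gl2_mul (upper y x0 z0) g) = (mu (v x) (v z))%:F * f g.
Proof.
have [e00 _ _ e11] := gl2E (upper_subproof y x0 z0).
by rewrite prin_seriesM; [rewrite e00 e11 | exact: borel_upper].
Qed.

(** The quotient of GL_2 by B is the projective line of bottom rows; [phi] is the chart (c : 1) and
    [psi] the chart (1 : d). *)
Definition phi (f : V) c : QA := f (nlow c).
Definition psi (f : V) d : QA := f (wlow d).

(** g is an upper triangular matrix with diagonal det g / g11, g11 times [nlow (g10 / g11)]. *)
Lemma prin_series_nlow (f : V) (g : gl2 F) : g 1 1 != 0 ->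
  f g = (mu (v (\det g / g 1 1)) (v (g 1 1)))%:F * phi f (g 1 0 / g 1 1).
Proof.
move=> g11; have x0 : \det g / g 1 1 != 0.
  by rewrite mulf_neq0 ?invr_eq0 // det_mx2 gl2_det.
rewrite -(prin_series_upper _ (g 0 1) x0 g11); congr (val f _).
have [u00 u01 u10 u11] := gl2E (upper_subproof (g 0 1) x0 g11).
have [n00 n01 n10 n11] := gl2E (nlow_subproof (g 1 0 / g 1 1)).
apply: gl2_eq; rewrite gl2_mulE ?u00 ?u01 ?u10 ?u11 ?n00 ?n01 ?n10 ?n11 ?det_mx2; by field.
Qed.

Lemma prin_series_wlow (f : V) (g : gl2 F) : g 1 0 != 0 ->
  f g = (mu (v (\det g / g 1 0)) (v (g 1 0)))%:F * psi f (g 1 1 / g 1 0).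
Proof.
move=> g10; have x0 : \det g / g 1 0 != 0.
  by rewrite mulf_neq0 ?invr_eq0 // det_mx2 gl2_det.
rewrite -(prin_series_upper _ (g 0 0) x0 g10); congr (val f _).
have [u00 u01 u10 u11] := gl2E (upper_subproof (g 0 0) x0 g10).
have [n00 n01 n10 n11] := gl2E (wlow_subproof (g 1 1 / g 1 0)).
apply: gl2_eq; rewrite gl2_mulE ?u00 ?u01 ?u10 ?u11 ?n00 ?n01 ?n10 ?n11 ?det_mx2; by field.
Qed.

(** The chart of [phi] misses only the point (1 : 0). *)
Lemma prin_series_ext (f f' : V) :
  (forall c, phi f c = phi f' c) -> psi f 0 = psi f' 0 -> f = f'.
Proof.
move=> phiE psiE; apply/val_inj/funext => g; change (f g = f' g).
have [g11|g11] := eqVneq (g 1 1) 0; last by rewrite !prin_series_nlow // phiE.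
have g10 : g 1 0 != 0.
  by apply: contraNneq (gl2_det g) => g10; rewrite g11 g10 !mulr0 subrr.
by rewrite !prin_series_wlow // g11 mul0r psiE.
Qed.

(** Change of chart: (c : 1) = (1 : c^-1). *)
Lemma phi_psi (f : V) c : c != 0 -> phi f c = (mu (- v c) (v c))%:F * psi f c^-1.
Proof.
move=> c0; have [n00 n01 n10 n11] := gl2E (nlow_subproof c).
rewrite /phi prin_series_wlow ?n10 // n11 !div1r.
by rewrite det_mx2 n00 n01 n10 n11 mul0r subr0 mulr1 div1r valuationV.
Qed.

Lemma phi_locally_constant (f : V) x :
  exists n, forall y, val_ge v n (y - x) -> phi f y = phi f x.
Proof.
have /asboolP[/(_ (nlow x))[n fn] _] := valP f; exists n => y yx; apply: fn => i j.
by rewrite !mxE; case: ifP => _; case: ifP => _; rewrite ?subrr //; apply: val_ge0.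
Qed.

Lemma psi_locally_constant (f : V) x :
  exists n, forall y, val_ge v n (y - x) -> psi f y = psi f x.
Proof.
have /asboolP[/(_ (wlow x))[n fn] _] := valP f; exists n => y yx; apply: fn => i j.
by rewrite !mxE; case: ifP => _; case: ifP => _; rewrite ?subrr //; apply: val_ge0.
Qed.

Lemma phiD f g c : phi (f + g) c = phi f c + phi g c. Proof. by []. Qed.
Lemma phiZ a f c : phi (a *: f) c = a * phi f c. Proof. by []. Qed.
Lemma phi0 c : phi 0 c = 0. Proof. by []. Qed.
Lemma psiD f g c : psi (f + g) c = psi f c + psi g c. Proof. by []. Qed.
Lemma psiN f c : psi (- f) c = - psi f c. Proof. by []. Qed.
Lemma psiZ a f c : psi (a *: f) c = a * psi f c. Proof. by []. Qed.
Lemma psi0 c : psi 0 c = 0. Proof. by []. Qed.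

(* The junk value at [a = 0] makes the action total. *)
Definition gl1_act (a : F) (f : V) : V :=
  if @idP (a != 0) is ReflectT a0 then rtranslate (gl1_embed a0) f else 0.

Lemma gl1_actE a f : a != 0 ->
  exists a0 : a != 0, gl1_act a f = rtranslate (gl1_embed a0) f.
Proof. by rewrite /gl1_act; case: {-}_ / idP => // a0 _; exists a0. Qed.

Lemma phi_gl1_act a f c : a != 0 -> phi (gl1_act a f) c = (alpha ^ v a)%:F * phi f (c * a).
Proof.
move=> /(gl1_actE f)[a0 ->].
have [n00 n01 n10 n11] := gl2E (nlow_subproof c).
have [d00 d01 d10 d11] := gl1_embedE a0.
set g := gl2_mul (nlow c) (gl1_embed a0).
have g10 : g 1 0 = c * a by rewrite gl2_mulE n10 n11 d00 d10 mulr0 addr0.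
have g11 : g 1 1 = 1 by rewrite gl2_mulE n10 n11 d01 d11 mulr0 add0r mulr1.
have gdet : \det g = a.
  by rewrite det_mx2 g10 g11 !gl2_mulE n00 n01 d00 d01 d10 d11; ring.
change (f g = (alpha ^ v a)%:F * phi f (c * a)).
rewrite prin_series_nlow g11 ?oner_neq0 // gdet g10 !divr1 valuation1.
by rewrite /mu expr0z mulr1.
Qed.

Lemma psi_gl1_act a f c : a != 0 -> psi (gl1_act a f) c = (eps ^ v a)%:F * psi f (c / a).
Proof.
move=> /(gl1_actE f)[a0 ->].
have [n00 n01 n10 n11] := gl2E (wlow_subproof c).
have [d00 d01 d10 d11] := gl1_embedE a0.
set g := gl2_mul (wlow c) (gl1_embed a0).
have g10 : g 1 0 = a by rewrite gl2_mulE n10 n11 d00 d10 mulr0 addr0 mul1r.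
have g11 : g 1 1 = c by rewrite gl2_mulE n10 n11 d01 d11 mulr0 add0r mulr1.
have gdet : \det g = a.
  by rewrite det_mx2 g10 g11 !gl2_mulE n00 n01 d00 d01 d10 d11; ring.
change (f g = (eps ^ v a)%:F * psi f (c / a)).
rewrite prin_series_wlow g10 // gdet g11 divff // valuation1.
by rewrite /mu expr0z mul1r.
Qed.

End PrincipalSeries.

(** * The invariant form *)

Lemma invf_mul_sub (K : fieldType) (t b x y : K) :
  t != 0 -> t^-1 * (x * t - b * (y * t)) = x - b * y.
Proof. by move=> t0; rewrite mulrA -mulrBl mulrCA mulVf // mulr1. Qed.

Section PrincipalSeries.
Variables (p : nat) (p_pr : prime p) (F : fieldExtType (padic p_pr)).
Variables (v : normalized_valuation F) (q : nat) (R : realType).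

Local Notation A := (laurent R[i]).
Local Notation QA := {fraction (laurent R[i])}.
Local Notation "f %:F" := (FracField.tofrac f) : ring_scope.
Local Notation V := (prin_series v q R).

Variables (alpha eps : A).
Hypotheses (ua : alpha \is a GRing.unit) (ue : eps \is a GRing.unit).
Hypothesis charE : forall b : gl2 F, borel b ->
  normalized_char v q R b = (alpha ^ v (b 0 0) * eps ^ v (b 1 1))%:F.

Local Notation phi_psi := (phi_psi charE).

Lemma val_ge0P c : val_ge v 0 c \/ [/\ c != 0, v c < 0 & val_ge v 0 c^-1].
Proof.
have [->|c0] := eqVneq c 0; first by left; apply: val_ge0.
have [vc|vc] := leP 0 (v c); first by left.
by right; split=> // _; rewrite valuationV // oppr_ge0 ltW.
Qed.

(** For c in O, [phi] is uniformly locally constant; for other c the chart [psi] is used at c^-1,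
    again in O. So one level serves all c. *)
Lemma phi_smooth (f : V) : exists n : nat, (0 < n)%N /\
  forall c x y, val_unit v x -> val_ge v n (x - y) -> phi f (c * x) = phi f (c * y).
Proof.
have [n1 f1] := integers_uniform (phi_locally_constant f).
have [n2 f2] := integers_uniform (psi_locally_constant f).
(* The summand 1 makes the level positive, so that y is a unit along with x. *)
exists (`|n1| + `|n2| + 1)%N; split=> [|c x y ux xy]; first by lia.
have n0 : 0 < (`|n1| + `|n2| + 1)%N%:Z by lia.
have uy := val_unit_close n0 ux xy.
have [Oc|[c0 _ Oc]] := val_ge0P c.
  apply: f1.
    by rewrite mulrC; apply: val_ge_unit.
  rewrite -mulrBr -[n1]add0r; apply: val_ge_mul Oc _.
  by apply: val_geW xy; lia.
have [/andP[x0 /eqP vx] /andP[y0 /eqP vy]] := (ux, uy).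
rewrite !phi_psi ?mulf_neq0 // !valuationM // vx vy; congr (_ * _).
rewrite !invfM; apply: f2.
  by rewrite mulrC; apply: val_ge_unit => //; apply: val_unitV.
rewrite -mulrBr -[n2]add0r; apply: val_ge_mul Oc _.
have -> : x^-1 - y^-1 = - ((x * y)^-1 * (x - y)) by field; rewrite x0 y0.
apply: val_ge_opp; apply: val_ge_unit; first by apply/val_unitV/val_unitM.
by apply: val_geW xy; lia.
Qed.

(** * The spherical function and characteristic functions of balls *)

Section Spherical.
Variables (fsph : V) (fsph_spherical : spherical fsph).
Local Notation beta := (alpha / eps).
Hypothesis beta1 : 1 - beta != 0.

Lemma spherical1 k : gl2_integers k -> fsph k = 1.
Proof.
move=> kK; have bB := borel_upper 0 (oner_neq0 F) (oner_neq0 F).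
have := fsph_spherical bB kK; rewrite (prin_series_upper charE) charE //.
have [u00 _ _ u11] := gl2E (upper_subproof 0 (oner_neq0 F) (oner_neq0 F)).
rewrite u00 u11 /mu valuation1 !expr0z mulr1.
by rewrite rmorph1 mul1r.
Qed.

Lemma integers01 : ring_of_integers (0 : F) /\ ring_of_integers (1 : F).
Proof.
by split; apply/(ring_of_integersE v); [exact: val_ge0 | move=> _; rewrite valuation1].
Qed.

Lemma phi_spherical c : val_ge v 0 c -> phi fsph c = 1.
Proof.
move=> /(ring_of_integersE v) Oc; have [O0 O1] := integers01.
apply: spherical1; split=> [i j|].
  by rewrite mxE; case: ifP => _; case: ifP.
have [n00 n01 n10 n11] := gl2E (nlow_subproof c).
by rewrite det_mx2 n00 n01 n10 n11 mul0r subr0 mulr1 invr1.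
Qed.

Lemma psi_spherical d : val_ge v 0 d -> psi fsph d = 1.
Proof.
move=> /(ring_of_integersE v) Od; have [O0 O1] := integers01.
apply: spherical1; split=> [i j|].
  rewrite mxE; case: ifP => _; case: ifP => // _.
  apply/(ring_of_integersE v)/val_ge_opp.
  exact/(ring_of_integersE v).
have [n00 n01 n10 n11] := gl2E (wlow_subproof d).
by rewrite det_mx2 n00 n01 n10 n11 mul0r sub0r mulN1r opprK invr1.
Qed.

Lemma muN m : mu alpha eps (- m) m = beta ^ (- m).
Proof. by rewrite /mu exprzMl ?unitrV // exprz_inv opprK. Qed.

Lemma phi_spherical_out c : c != 0 -> v c <= 0 -> phi fsph c = (beta ^ (- v c))%:F.
Proof.
move=> c0 vc; rewrite phi_psi // psi_spherical ?mulr1 ?muN // => _.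
by rewrite valuationV // oppr_ge0.
Qed.

Variables (w : F) (w0 : w != 0) (vw : v w = 1).

Let vwX j : v (w ^ j) = j.
Proof. by rewrite valuationXz // vw mulr1. Qed.

Let wX0 j : w ^ j != 0.
Proof. exact: expfz_neq0. Qed.

(** The scalar cancels the twist in [phi_gl1_act], so that [phi] is merely dilated. *)
Definition spherical_shift (j : int) : V := (alpha ^ j)%:F *: gl1_act (w ^ (- j)) fsph.

Lemma phi_spherical_shift j c : phi (spherical_shift j) c = phi fsph (c * w ^ (- j)).
Proof.
rewrite phiZ (phi_gl1_act charE) ?wX0 // vwX mulrA -rmorphM -exprzDr // subrr expr0z.
by rewrite rmorph1 mul1r.
Qed.

Lemma psi_spherical_shift j : psi (spherical_shift j) 0 = (beta ^ j)%:F.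
Proof.
rewrite psiZ (psi_gl1_act charE) ?wX0 // vwX mul0r psi_spherical ?mulr1; last exact: val_ge0.
by rewrite -rmorphM exprzMl ?unitrV // exprz_inv.
Qed.

(* Supported on the big cell, where it is the characteristic function of
   varpi^j O. *)
Definition ball_series (j : int) : V :=
  ((1 - beta)%:F)^-1 *: (spherical_shift j - beta%:F *: spherical_shift (j - 1)).

Let tbeta1 : (1 - beta)%:F != 0 :> QA.
Proof. by rewrite tofrac_eq0. Qed.

Let ub : beta \is a GRing.unit.
Proof. by rewrite unitrM ua unitrV. Qed.

Lemma phi_ballE j c : phi (ball_series j) c = ((1 - beta)%:F)^-1 *
  (phi (spherical_shift j) c - beta%:F * phi (spherical_shift (j - 1)) c).
Proof. by []. Qed.

Lemma psi_ballE j c : psi (ball_series j) c = ((1 - beta)%:F)^-1 *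
  (psi (spherical_shift j) c - beta%:F * psi (spherical_shift (j - 1)) c).
Proof. by []. Qed.

Lemma phi_ball_in j c : val_ge v j c -> phi (ball_series j) c = 1.
Proof.
move=> jc; rewrite phi_ballE !phi_spherical_shift.
have shift (k : int) : k <= j -> val_ge v 0 (c * w ^ (- k)).
  move=> kj; rewrite -(subrr k); apply: val_ge_mul; first exact: val_geW jc.
  by move=> _; rewrite vwX.
rewrite !(phi_spherical (shift _ _)) //; last by lia.
by rewrite mulr1 -(rmorph1 (@FracField.tofrac A)) -rmorphB mulVf.
Qed.

Lemma phi_ball_out j c : c != 0 -> v c < j -> phi (ball_series j) c = 0.
Proof.
move=> c0 cj; rewrite phi_ballE !phi_spherical_shift.
have vE k : v (c * w ^ (- k)) = v c - k by rewrite valuationM ?wX0 // vwX.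
(* The power formula holds at valuation 0 too, which covers v(c) = j - 1 in the second shift; both
   terms then equal beta^(j - v(c)). *)
have out k : j - 1 <= k -> phi fsph (c * w ^ (- k)) = (beta ^ (k - v c))%:F.
  by move=> jk; rewrite phi_spherical_out ?mulf_neq0 ?wX0 // vE ?opprB //; lia.
rewrite !out ?lexx //; last by lia.
rewrite -rmorphM -[X in X * _ ^ _]expr1z -exprzDr //.
by rewrite (_ : 1 + (j - 1 - v c) = j - v c) ?subrr ?mulr0 //; lia.
Qed.

Lemma psi_ball j : psi (ball_series j) 0 = 0.
Proof.
rewrite psi_ballE !psi_spherical_shift.
rewrite -rmorphM -[X in X * _ ^ _]expr1z -exprzDr // [1 + (j - 1)]addrC subrK.
by rewrite subrr mulr0.
Qed.

(** * Values of the invariant form *)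

Variable l : {linear V -> QA^o}.
Hypothesis l_invariant : gl1_invariant l.
Hypothesis l_normalized : l fsph = (1 - beta)%:F.

Let lZ a f : l (a *: f) = a * l f :> QA.
Proof. by rewrite linearZ. Qed.

Lemma l_gl1_act a f : a != 0 -> l (gl1_act a f) = l f.
Proof. by move=> /(gl1_actE f)[a0 ->]; apply: l_invariant. Qed.

(** By invariance the shift by j has value alpha^j (1 - beta), and beta alpha^(j - 1) = alpha^j
    eps^-1. *)
Lemma l_ball j : l (ball_series j) = (alpha ^ j * (1 - eps^-1))%:F.
Proof.
rewrite lZ linearB !lZ !l_gl1_act ?wX0 // l_normalized.
transitivity ((alpha ^ j)%:F - beta%:F * (alpha ^ (j - 1))%:F); first exact: invf_mul_sub.
rewrite -rmorphM -rmorphB; congr (_ %:F).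
rewrite exprzDr // [alpha ^ (- 1)]exprN1 mulrBr mulr1; congr (_ - _).
by rewrite mulrC mulrA mulrVK.
Qed.

(** Induction on the number of shells v(c) = j, j + 1, ... on which G may vary: subtracting its
    value on the first shell times [ball_series j] moves the support to the next ball. With no shell
    left, G is a multiple of one ball. *)
Lemma l_step (n : nat) : forall (j : int) (G : V),
    psi G 0 = 0 ->
    (forall c c', c != 0 -> c' != 0 -> v c = v c' -> phi G c = phi G c') ->
    (forall c, exists a, phi G c = a%:F) ->
    (forall c, c != 0 -> v c < j -> phi G c = 0) ->
    (forall c, val_ge v (j + n%:Z) c -> phi G c = phi G 0) ->
  exists a, l G = ((1 - eps^-1) * a)%:F.
Proof.
elim: n => [|n IHn] j G G_psi G_val G_A G_out G_in.
  have [a aE] := G_A 0.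
  suff -> : G = a%:F *: ball_series j.
    exists (a * alpha ^ j); rewrite lZ l_ball -rmorphM.
    by congr (_ %:F); rewrite mulrA mulrC.
  apply: (prin_series_ext charE) => [c|]; last by rewrite psiZ psi_ball mulr0.
  rewrite phiZ; have [jc|njc] := pselect (val_ge v j c).
    by rewrite phi_ball_in // mulr1 -aE; apply: G_in; rewrite addr0.
  have c0 : c != 0 by apply/eqP => c0; apply: njc; rewrite c0; apply: val_ge0.
  have cj : v c < j by rewrite ltNge; apply/negP => jc; apply: njc.
  by rewrite phi_ball_out // mulr0 G_out.
have [a aE] := G_A (w ^ j).
pose G' := G - a%:F *: ball_series j.
have G'E c : phi G' c = phi G c - a%:F * phi (ball_series j) c by [].
have [|c c' c0 c0' cc'|c|c c0 cj|c jc|b bE] := IHn (j + 1) G'.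
- by rewrite psiD psiN psiZ psi_ball mulr0 subr0.
- rewrite !G'E (G_val _ _ c0 c0' cc').
  have [jc|cj] := leP j (v c).
    by rewrite !phi_ball_in // => _; rewrite -cc'.
  by rewrite !phi_ball_out // -cc'.
- rewrite G'E; have [b ->] := G_A c.
  have [jc|njc] := pselect (val_ge v j c).
    by exists (b - a); rewrite phi_ball_in // mulr1 rmorphB.
  exists b; rewrite phi_ball_out ?mulr0 ?subr0 //.
    by apply/eqP => c0; apply: njc; rewrite c0; apply: val_ge0.
  by rewrite ltNge; apply/negP => jc; apply: njc.
- rewrite G'E; have [cj'|jc] := ltP (v c) j.
    by rewrite phi_ball_out // mulr0 subr0 G_out.
  have vcj : v c = v (w ^ j) by rewrite vwX; clear -cj jc; lia.
  by rewrite (G_val _ _ c0 (wX0 j) vcj) aE phi_ball_in // mulr1 subrr.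
- rewrite !G'E !phi_ball_in; [|exact: val_ge0|by apply: val_geW jc; clear; lia].
  by rewrite G_in //; apply: val_geW jc; clear; lia.
exists (b + alpha ^ j * a).
rewrite -(subrK (a%:F *: ball_series j) G) -/G' linearD bE lZ l_ball.
rewrite -rmorphM -rmorphD; congr (_ %:F); rewrite [RHS]mulrDr; congr (_ + _).
by rewrite mulrC [_ * (1 - _)]mulrC mulrA.
Qed.

Lemma phi_sum (I : Type) (r : seq I) (G : I -> V) c :
  phi (\sum_(i <- r) G i) c = \sum_(i <- r) phi (G i) c.
Proof. by elim/big_rec2: _ => [|i _ x _ <-]; rewrite ?phi0 ?phiD. Qed.

Lemma psi_sum (I : Type) (r : seq I) (G : I -> V) c :
  psi (\sum_(i <- r) G i) c = \sum_(i <- r) psi (G i) c.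
Proof. by elim/big_rec2: _ => [|i _ x _ <-]; rewrite ?psi0 ?psiD. Qed.

Lemma tofrac_sum (I : eqType) (r : seq I) (g : I -> QA) :
  (forall i, i \in r -> exists a, g i = a%:F) -> exists a, \sum_(i <- r) g i = a%:F.
Proof.
elim: r => [|i r IHr] gA; first by exists 0; rewrite big_nil rmorph0.
have [a aE] := gA i (mem_head _ _).
have [|b bE] := IHr; first by move=> j jr; apply: gA; rewrite inE jr orbT.
by exists (a + b); rewrite big_cons aE bE rmorphD.
Qed.

Lemma l_integral (hq : residue_field_card v q) (f : V) : integral_series f ->
  exists a b, l f = ((1 - eps^-1) * a + (1 - beta) * b)%:F.
Proof.
move=> f_int; have [n [n0 f_smooth]] := phi_smooth f.
have [s [s_nil s_unit s_avg]] := unit_average hq n0.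
have s0 r : r \in s -> r != 0 by move=> /s_unit/andP[].
have sv r : r \in s -> v r = 0 by move=> /s_unit/andP[_ /eqP].
(* The average without its denominator; the division by the size of [s] comes at the end. *)
pose fav := \sum_(r <- s) gl1_act r f.
have phi_fav c : phi fav c = \sum_(r <- s) phi f (c * r).
  rewrite phi_sum; apply: eq_big_seq => r rs.
  by rewrite (phi_gl1_act charE) ?s0 // sv // expr0z rmorph1 mul1r.
have [a0 psi_fav] : exists a, psi fav 0 = a%:F.
  rewrite psi_sum; apply: tofrac_sum => r rs.
  rewrite (psi_gl1_act charE) ?s0 // sv // expr0z rmorph1 mul1r mul0r.
  exact: f_int.
(* Removing the value at the Weyl element confines the support to the big cell. *)
pose G := fav - a0%:F *: fsph.
have GE c : phi G c = phi fav c - a0%:F * phi fsph c by [].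
have G_psi : psi G 0 = 0.
  rewrite psiD psiN psiZ psi_spherical ?mulr1 ?psi_fav ?subrr //; exact: val_ge0.
have sph_val c c' : c != 0 -> c' != 0 -> v c = v c' -> phi fsph c = phi fsph c'.
  move=> c0 c0' cc'; have [vc|vc] := leP 0 (v c).
    by rewrite !phi_spherical // => _; rewrite -cc'.
  by rewrite !phi_spherical_out ?cc' // -cc' ltW.
have G_val c c' : c != 0 -> c' != 0 -> v c = v c' -> phi G c = phi G c'.
  move=> c0 c0' cc'; rewrite !GE (sph_val _ _ c0 c0' cc'); congr (_ - _).
  (* c' is a unit multiple of c, and the sum over [s] absorbs this unit. *)
  have uu : val_unit v (c' / c).
    apply/andP; split; first by rewrite mulf_neq0 ?invr_eq0.
    by rewrite valuationM ?valuationV ?invr_eq0 // cc'; apply/eqP/subrr.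
  rewrite !phi_fav -(s_avg QA (fun r => phi f (c * r)) _ _ uu); last exact: f_smooth.
  by apply: eq_bigr => r _; rewrite mulrA mulrCA divff // mulr1.
have G_A c : exists a, phi G c = a%:F.
  have [a aE] : exists a, phi fav c = a%:F.
    by rewrite phi_fav; apply: tofrac_sum => r _; apply: f_int.
  have [b bE] : exists b, phi fsph c = b%:F.
    have [Oc|[c0 vc _]] := val_ge0P c.
      by exists 1; rewrite phi_spherical // rmorph1.
    by exists (beta ^ (- v c)); rewrite phi_spherical_out // ltW.
  by exists (a - a0 * b); rewrite GE aE bE rmorphB rmorphM.
have [n1 Gn1] := phi_locally_constant G 0.
have [n2 Gn2] := psi_locally_constant G 0.
(* Below valuation -(|n2| + 1), c^-1 is so close to 0 that [psi G] vanishes there; from that start,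
   |n1| + |n2| + 1 shells lead to level |n1|, where [phi G] is constant. *)
have [c c0 vc|c cn|a aE] :=
  @l_step (`|n1| + `|n2| + 1)%N (- (`|n2| + 1)%N%:Z) G G_psi G_val G_A.
- rewrite phi_psi // Gn2 ?G_psi ?mulr0 // subr0 => _.
  by rewrite valuationV //; move: vc; clear; lia.
- apply: Gn1; rewrite subr0; apply: val_geW cn; clear; lia.
have l_fav : l fav = l f *+ size s.
  rewrite linear_sum (eq_big_seq (fun=> l f)) => [|r rs]; last by rewrite l_gl1_act ?s0.
  by rewrite big_const_seq count_predT iter_addr_0.
(* [s] is nonempty, so its size is invertible in C. *)
pose N : A := laurentC (size s)%:R^-1.
have NE : N * (size s)%:R = 1.
  rewrite -(rmorph_nat (@laurentC R[i])) -rmorphM mulVf ?rmorph1 //.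
  by rewrite pnatr_eq0 size_eq0.
exists (N * a), (N * a0).
have favE : l fav = ((1 - eps^-1) * a + a0 * (1 - beta))%:F.
  rewrite -(subrK (a0%:F *: fsph) fav) -/G linearD aE lZ l_normalized.
  by rewrite -rmorphM -rmorphD.
transitivity (N%:F * l fav).
  rewrite l_fav -mulr_natr -(rmorph_nat (@FracField.tofrac A)) mulrCA -rmorphM.
  by rewrite NE rmorph1 mulr1.
rewrite favE -rmorphM; congr (_ %:F).
by rewrite mulrDr [N * (_ * a)]mulrCA [a0 * _]mulrC [N * (_ * a0)]mulrCA.
Qed.

(** 1 - eps^-1 = -eps^-1 (1 - eps), and 1 - eps may replace 1 - alpha as a generator. *)
Lemma l_integral_ideal2 (hq : residue_field_card v q) (f : V) : integral_series f ->
  exists2 a, ideal2 (1 - alpha) (1 - beta) a & l f = a%:F.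
Proof.
move=> /(l_integral hq)[a [b lE]]; exists ((1 - eps^-1) * a + (1 - beta) * b) => //.
rewrite ideal2_div //; exists (- eps^-1 * a), b.
by rewrite [in RHS]mulrA mulrN [(1 - eps) * _]mulrBl mul1r divrr // opprB.
Qed.

End Spherical.
End PrincipalSeries.

(** * Specialization to alpha = q^(-1/2) X1 and eps = q^(1/2) X2 *)

Theorem theorem3p1 (R : realType) (p : nat) (p_pr : prime p)
  (F : fieldExtType (padic p_pr)) (v : normalized_valuation F)
  (q : nat) (hq : residue_field_card v q)
  (fsph : prin_series v q R) (fsph_spherical : spherical fsph)
  (l : {linear prin_series v q R -> {fraction (laurent R[i])}^o})
  (l_invariant : gl1_invariant l)
  (l_normalized : l fsph = FracField.tofrac
     (1 - laurentC (q%:R^-1 : R[i]) * X1 R[i] / X2 R[i])) :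
  let c : laurent R[i] := 1 - laurentC (q%:R^-1 : R[i]) * X1 R[i] / X2 R[i] in
  let sqrtq : R[i] := (Num.sqrt (q%:R : R))%:C%C in
  let I := ideal2 (1 - laurentC sqrtq^-1 * X1 R[i]) c in
  [/\ forall f, integral_series f ->
        exists2 a : laurent R[i], I a & l f = FracField.tofrac a,
      I = ideal2 (1 - laurentC sqrtq * X2 R[i]) c
    & ~ @free_submodule (laurent R[i]) (laurent R[i])^o I].
Proof.
(* The residue class of 0 provides an index below q. *)
have q_gt0 : (0 < q)%N.
  have [rep [_ repP]] := hq.
  have [|i _] := repP 0; first by apply/(ring_of_integersE v)/val_ge0.
  by apply: leq_ltn_trans (ltn_ord i).
have k0 := sqrtq_neq0 R q_gt0.
have ua := alpha_unit k0; have ue := eps_unit k0.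
have no_bezout := laurent_no_bezout k0.
have charE (b : gl2 F) (bB : borel b) := @normalized_charE p p_pr F v q R q_gt0 b bB.
(* The normalizing value is 1 - beta with beta = alpha / eps. *)
have cE : laurentC (q%:R^-1 : R[i]) * X1 R[i] / X2 R[i] =
    (laurentC ((Num.sqrt (q%:R : R))%:C%C)^-1 * X1 R[i]) /
    (laurentC (Num.sqrt (q%:R : R))%:C%C * X2 R[i]).
  by rewrite div_alpha_eps // sqrtq_sqr.
have beta1 := one_sub_div_neq0 ue no_bezout.
have [w [w0 vw]] := valuation_uniformizer v.
rewrite cE in l_normalized *; split; last exact: ideal2_not_free.
  move=> f; exact: (l_integral_ideal2 ua ue charE fsph_spherical beta1 w0 vw
    l_invariant l_normalized hq).
exact: ideal2_div.
Qed.
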